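(* Assume the standing setting described in the context, with $\varepsilon$ fixed, and let $\alpha>1$, $\delta>0$, $c_0,c_1,c_2>0$, $a_1(\alpha)>0$ satisfy (L1) and (L2) below, and let $b_0,b_1>0$ satisfy (L3) below for this $\delta$: (L1) for every solution $x$ of (S) and every $t\ge0$ with $\|x_t\|_h\le\delta$, $\frac{d}{dt}v(t,x_t)\le-c_0\|x(t)\|^{\gamma+\mu-1}-c_1\|x(t-h)\|^{\gamma+\mu-1}-c_2\int_{-h}^0\|x(t+\theta)\|^{\gamma+\mu-1}d\theta$; (L2) for all $t\ge0$ and $\varphi\in S_\alpha$ with $\|\varphi\|_h\le\delta$, $v(t,\varphi)\ge a_1(\alpha)\|\varphi(0)\|^\gamma+\mathrm w_1\int_{-h}^0\|\varphi(\theta)\|^{\gamma+\mu-1}d\theta$; (L3) for all $t\ge0$ and $\varphi$ with $\|\varphi\|_h\le\delta$, $v(t,\varphi)\le b_0\|\varphi(0)\|^\gamma+b_1\int_{-h}^0\|\varphi(\theta)\|^\gamma d\theta$. Let $b_2=(\beta m+\mathrm w_1+h\mathrm w_2)h$, $b_3=\beta p(\hat bh+\omega(\varepsilon)/\varepsilon)$, and let $\Delta>0$ be a positive root of $\alpha_1\Delta^\gamma+b_2\Delta^{\gamma+\mu-1}+b_3\Delta^{\gamma+\sigma-1}=a_1(\alpha)\delta^\gamma$. Put $b=\max\{b_0,b_1\}$, $c=\min\{c_0,c_2\}$, $K_\Delta=\alpha_1+b_2\Delta^{\mu-1}+b_3\Delta^{\sigma-1}$ and $$\rho=\frac{c}{b^{\frac{\gamma+\mu-1}{\gamma}}\big(2\max\{1,h\}\big)^{\frac{\mu-1}{\gamma}}}.$$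 Let $\tilde\rho\in(0,\rho)$ satisfy $$1+\tilde\rho\, h\,\frac{\mu-1}{\gamma}\,K_\Delta^{\frac{\mu-1}{\gamma}}\,\Delta^{\mu-1}\le\alpha^{\mu-1}.$$ Then for every $\varphi\in C_{[-h,0]}$ with $\|\varphi\|_h<\Delta$ and all $t\ge0$, $$\|x(t,\varphi)\|\le\hat c_1\|\varphi\|_h\Big[1+\hat c_2\|\varphi\|_h^{\mu-1}t\Big]^{-\frac1{\mu-1}},$$ where $\hat c_1=\big(K_\Delta/a_1(\alpha)\big)^{1/\gamma}$ and $\hat c_2=\tilde\rho\,\frac{\mu-1}{\gamma}\,K_\Delta^{\frac{\mu-1}{\gamma}}$.
   Context: Standing setting. Fix $n\ge1$ and a delay $h>0$. $\|\cdot\|$ is the Euclidean norm on $\mathbb R^n$ (and the induced operator norm on matrices). $C_{[-h,0]}$ is the space of continuous $\varphi:[-h,0]\to\mathbb R^n$ with norm $\|\varphi\|_h=\max_{\theta\in[-h,0]}\|\varphi(\theta)\|$. Consider system (S): $\dot x(t)=f(x(t),x(t-h))+B(t)Q(x(t),x(t-h))$, $t\ge0$, with initial function $\varphi\in C_{[-h,0]}$; $x(t,\varphi)$ denotes its solution and $x_t\in C_{[-h,0]}$ is the state $x_t(\theta)=x(t+\theta)$, $\theta\in[-h,0]$. Assumptions: (i) $f:\mathbb R^n\times\mathbb R^n\to\mathbb R^n$ is Lipschitz, continuously differentiable in both arguments, and homogeneous of degree $\mu>1$: $f(c\mathrm x_1,c\mathrm x_2)=c^\mu f(\mathrm x_1,\mathrm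 x_2)$ for all $c>0$; constants $m_1,m_2,\eta_{11},\eta_{12}\ge0$ are such that $\|f(\mathrm x_1,\mathrm x_2)\|\le m_1\|\mathrm x_1\|^\mu+m_2\|\mathrm x_2\|^\mu$ and $\|\partial f/\partial \mathrm x_1(\mathrm x_1,\mathrm x_2)\|\le \eta_{11}\|\mathrm x_1\|^{\mu-1}+\eta_{12}\|\mathrm x_2\|^{\mu-1}$. (ii) $B:[0,\infty)\to\mathbb R^{n\times n}$ is continuous with $\|B(t)\|\le\hat b$ for all $t$. (iii) $Q:\mathbb R^n\times\mathbb R^n\to\mathbb R^n$ is continuously differentiable and, for some $\sigma>1$ and constants $p_1,p_2,q_{jk}\ge0$, $\|Q(\mathrm x_1,\mathrm x_2)\|\le p_1\|\mathrm x_1\|^\sigma+p_2\|\mathrm x_2\|^\sigma$ and $\|\partial Q/\partial\mathrm x_j(\mathrm x_1,\mathrm x_2)\|\le q_{j1}\|\mathrm x_1\|^{\sigma-1}+q_{j2}\|\mathrm x_2\|^{\sigma-1}$, $j=1,2$. (iv) The delay-free system $\dot x=f(x,x)$ is asymptotically stable, and $V:\mathbb R^n\to\mathbb R$ is a positive definite, twice continuously differentiable function, homogeneous of degree $\gamma\ge2$, with constants $\mathrm w,\alpha_0,\alpha_1,\beta,\psi>0$ such that $(\partial V/\partial\mathrm x)^T f(\mathrm x,\mathrm x)\le-\mathrm w\|\mathrm x\|^{\gamma+\mu-1}$, $\alpha_0\|\mathrm x\|^\gamma\le V(\mathrm x)\le\alpha_1\|\mathrm x\|^\gamma$, $\|\partial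 V/\partial\mathrm x\|\le\beta\|\mathrm x\|^{\gamma-1}$, $\|\partial^2V/\partial\mathrm x^2\|\le\psi\|\mathrm x\|^{\gamma-2}$. Perturbation classes: case (a): $\int_0^tB(s)\,ds$ is bounded on $t\ge0$ and $\sigma>(\mu+1)/2$; case (b): $\frac1T\int_t^{t+T}B(s)\,ds\to0$ as $T\to+\infty$ uniformly in $t\ge0$, and $\sigma\ge\mu$. Define $L(t,\varepsilon)=\int_0^{t+h}e^{-\varepsilon(t+h-s)}B(s)\,ds$, where $\varepsilon=0$ in case (a) and $\varepsilon>0$ is a parameter in case (b). In case (b), $\omega(\varepsilon):=\sup_{t\ge0}\varepsilon\|L(t,\varepsilon)\|$ is finite and $\omega(\varepsilon)\to0$ as $\varepsilon\to0$. In case (a) let $l_0>0$ with $\|L(t,0)\|\le l_0$ for all $t\ge0$, and throughout read $\omega(\varepsilon)$ as $0$ and $\omega(\varepsilon)/\varepsilon$ as $l_0$. Fix $\mathrm w_1,\mathrm w_2>0$ with $\mathrm w_0:=\mathrm w-\mathrm w_1-h\mathrm w_2>0$. The functional $v:[0,\infty)\times C_{[-h,0]}\to\mathbb R$ is $v(t,\varphi)=V(\varphi(0))+\Big(\frac{\partial V}{\partial\mathrm x}(\varphi(0))\Big)^T\Big(\int_{-h}^0\big(f(\varphi(0),\varphi(\theta))+B(t+\theta+h)Q(\varphi(0),\varphi(\theta))\big)d\theta-L(t,\varepsilon)Q(\varphi(0),\varphi(0))\Big)+\int_{-h}^0(\mathrm w_1+(h+\theta)\mathrm w_2)\|\varphi(\theta)\|^{\gamma+\mu-1}d\theta.$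 For $\alpha>1$, $S_\alpha=\{\varphi\in C_{[-h,0]}:\|\varphi(\theta)\|\le\alpha\|\varphi(0)\|\ \forall\theta\in[-h,0]\}$. Notation: $m=m_1+m_2$, $p=p_1+p_2$. *)

(* Defs.v *)
From HB Require Import structures.
From mathcomp Require Import all_boot all_order all_algebra.
From mathcomp Require Import all_classical all_reals all_analysis.
Set Implicit Arguments.
Unset Strict Implicit.
Unset Printing Implicit Defensive.
Import Order.TTheory GRing.Theory Num.Theory.
Import numFieldNormedType.Exports.
Local Open Scope classical_set_scope.
Local Open Scope ring_scope.

Section Defs.
Variables (R : realType) (n : nat).
Local Notation vec := 'cV[R]_n.
Local Notation mat := 'M[R]_n.

Definition enorm (x : vec) : R := Num.sqrt (\sum_(i < n) x i ord0 ^+ 2).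

Definition dotv (x y : vec) : R := \sum_(i < n) x i ord0 * y i ord0.

Definition opnorm (L : vec -> vec) : R :=
  sup [set enorm (L u) | u in [set u : vec | enorm u <= 1]].

Definition mnorm (A : mat) : R := opnorm (fun u => A *m u).

Definition ebasis (i : 'I_n) : vec := delta_mx i ord0.

Definition rint (a b : R) (g : R -> R) : R :=
  Rintegral lebesgue_measure `[a, b] g.

Definition vint (a b : R) (F : R -> vec) : vec :=
  \col_(i < n) rint a b (fun s => F s i ord0).
Definition mint (a b : R) (F : R -> mat) : mat :=
  \matrix_(i < n, j < n) rint a b (fun s => F s i j).

Definition pd1 (g : vec * vec -> vec) (x1 x2 : vec) : vec -> vec :=
  fun u => 'd g (x1, x2) (u, 0).
Definition pd2 (g : vec * vec -> vec) (x1 x2 : vec) : vec -> vec :=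
  fun u => 'd g (x1, x2) (0, u).

Definition grad (V : vec -> R) (x : vec) : vec :=
  \col_(i < n) ('d V x (ebasis i)).
Definition hess (V : vec -> R) (x : vec) : vec -> vec :=
  fun u => \col_(i < n) ('d (fun y => 'd V y (ebasis i)) x u).

Definition C1_pair (g : vec * vec -> vec) : Prop :=
  (forall z, differentiable g z) /\ (forall w, continuous (fun z => 'd g z w)).
Definition C2_scalar (V : vec -> R) : Prop :=
  (forall x, differentiable V x) /\
  (forall u x, differentiable (fun y => 'd V y u) x) /\
  (forall u w, continuous (fun x => 'd (fun y => 'd V y u) x w)).

Definition loc_lipschitz (g : vec * vec -> vec) : Prop :=
  forall r : R, 0 < r -> exists K : R, forall a1 a2 b1 b2 : vec,
    enorm a1 <= r -> enorm a2 <= r -> enorm b1 <= r -> enorm b2 <= r ->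
    enorm (g (a1, a2) - g (b1, b2)) <= K * (enorm (a1 - b1) + enorm (a2 - b2)).

Definition is_sol0 (f : vec * vec -> vec) (y : R -> vec) : Prop :=
  {within `[0, +oo[, continuous y} /\
  forall t, 0 < t -> derivable y t 1 /\ 'D_1 y t = f (y t, y t).

Definition asympt_stable0 (f : vec * vec -> vec) : Prop :=
  (forall e : R, 0 < e -> exists d : R, 0 < d /\
     forall y, is_sol0 f y -> enorm (y 0) < d -> forall t, 0 <= t -> enorm (y t) < e) /\
  (exists d0 : R, 0 < d0 /\
     forall y, is_sol0 f y -> enorm (y 0) < d0 -> (fun t => enorm (y t)) @ +oo --> (0 : R)).

(* norm of C_[-h,0] : max over [-h,0] (sup = max for continuous phi) *)
Definition normh (h : R) (phi : R -> vec) : R :=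
  sup [set enorm (phi th) | th in `[- h, 0]].

Definition isC (h : R) (phi : R -> vec) : Prop :=
  {within `[- h, 0], continuous phi}.

Definition state (x : R -> vec) (t : R) : R -> vec := fun th => x (t + th).

Definition is_solS (f Q : vec * vec -> vec) (B : R -> mat) (h : R)
    (phi : R -> vec) (x : R -> vec) : Prop :=
  (forall th, - h <= th <= 0 -> x th = phi th) /\
  {within `[- h, +oo[, continuous x} /\
  forall t, 0 < t -> derivable x t 1 /\
    'D_1 x t = f (x t, x (t - h)) + B t *m Q (x t, x (t - h)).

Definition S_alpha (h alpha : R) (phi : R -> vec) : Prop :=
  forall th, - h <= th <= 0 -> enorm (phi th) <= alpha * enorm (phi 0).

Definition Lmat (B : R -> mat) (h eps t : R) : mat :=
  mint 0 (t + h) (fun s => expR (- (eps * (t + h - s))) *: B s).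

Definition omega (B : R -> mat) (h eps : R) : R :=
  sup [set eps * mnorm (Lmat B h eps t) | t in `[0, +oo[].

(* omega(eps)/eps, read as l0 in case (a) (eps = 0) *)
Definition omega_over_eps (B : R -> mat) (h eps l0 : R) : R :=
  if eps == 0 then l0 else omega B h eps / eps.

Definition case_a (B : R -> mat) (mu sigma : R) : Prop :=
  (exists M : R, forall t, 0 <= t -> mnorm (mint 0 t B) <= M) /\
  (mu + 1) / 2 < sigma.

Definition case_b (B : R -> mat) (mu sigma : R) : Prop :=
  (forall e : R, 0 < e -> exists T0 : R, forall T t, T0 <= T -> 0 < T -> 0 <= t ->
      mnorm (T^-1 *: mint t (t + T) B) <= e) /\
  mu <= sigma.

Definition vfun (f Q : vec * vec -> vec) (B : R -> mat) (V : vec -> R)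
    (h eps gamma mu w1 w2 t : R) (phi : R -> vec) : R :=
  V (phi 0)
  + dotv (grad V (phi 0))
      (vint (- h) 0 (fun th => f (phi 0, phi th) + B (t + th + h) *m Q (phi 0, phi th))
       - Lmat B h eps t *m Q (phi 0, phi 0))
  + rint (- h) 0 (fun th => (w1 + (h + th) * w2) * powR (enorm (phi th)) (gamma + mu - 1)).

End Defs.

Section Deriv.
Variable (R : realType).
Definition rderiv_le (g : R -> R) (t D : R) : Prop :=
  exists D' : R, (fun s => (g (t + s) - g t) / s) @ at_right 0 --> D' /\ D' <= D.
End Deriv.

(* Main.v *)
Require Import Defs.
From HB Require Import structures.
From mathcomp Require Import all_boot all_order all_algebra.
From mathcomp Require Import all_classical all_reals all_analysis.
From mathcomp Require Import ring lra.
Set Implicit Arguments.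
Unset Strict Implicit.
Unset Printing Implicit Defensive.
Import Order.TTheory GRing.Theory Num.Theory.
Import numFieldNormedType.Exports.
Local Open Scope classical_set_scope.
Local Open Scope ring_scope.

(** Along a solution x, (L1), (L3) and Jensen's inequality turn v into a
    subsolution of u' = - rho u^(1 + kappa), kappa = (mu - 1) / gamma, for as
    long as the state stays in the ball of radius delta, so v is dominated by
    the explicit solutions of u' = - rho_t u^(1 + kappa).  As
    u^(- kappa) is affine in t, these solutions are the functions [profile].
    Given ||phi||_h < r < Delta, suppose that a1 |x|^gamma exceeds the profile
    issued from K r^gamma, and look at the first time it reaches it.  Up to
    then the profile bounds the history of x, which is thus smaller than
    delta; and as the profile decreases by a factor at most alpha^gamma over a
    delay (the condition on rho_t), the state lies in S_alpha.  Now (L2) bounds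
    a1 |x|^gamma by v, hence by the profile issued from K s^gamma for some
    s < r, a contradiction.  Finally r tends to ||phi||_h, which also covers
    phi = 0. *)

(** * First zeros and differential inequalities *)

(** The set of points of [[0, T]] where [G] is nonnegative is compact, so it has a least element;
    the intermediate value theorem makes [G] vanish there. *)
Lemma first_zero (R : realType) (G : R -> R) (T : R) :
  continuous G -> 0 <= T -> G 0 < 0 -> 0 <= G T ->
  exists s, [/\ 0 <= s <= T, G s = 0 & forall u, 0 <= u <= s -> G u <= 0].
Proof.
move=> cG T0 G0 GT.
pose A := `[0, T] `&` [set t | 0 <= G t].
have cA : compact A.
  apply: (@subclosed_compact _ _ `[0, T]); last by move=> t [].
    apply: closedI; first exact: interval_closed.
    by move/continuous_closedP: cG => /(_ _ (@closed_ge _ 0)).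
  exact: segment_compact.
have A0 : A !=set0 by exists T; split => //=; rewrite in_itv/= T0 lexx.
have [s /set_mem[/= sT Gs] smin] := compact_EVT_min A0 cA
  (@continuous_subspaceT _ _ A id (fun x => cvg_id)).
have {}smin t : 0 <= t <= T -> 0 <= G t -> s <= t.
  by move=> tT Gt; apply: smin; apply/mem_set; split => //=; rewrite in_itv.
move: sT; rewrite in_itv/= => /andP[s0 sT].
(* The zero [c] lies in [[0, s]], and minimality of [s] forces [c = s]. *)
have [|c cs Gc] := @IVT _ G 0 s 0 s0 (continuous_subspaceT cG).
  by rewrite min_l ?max_r ?(ltW (lt_le_trans G0 Gs))// Gs ltW.
move: cs; rewrite in_itv/= => /andP[c0 cs].
have sc : s = c.
  by apply/eqP; rewrite eq_le cs andbT smin ?Gc// c0 (le_trans cs).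
exists s; split; [by rewrite s0|by rewrite sc|].
move=> u /andP[u0]; rewrite le_eqVlt => /predU1P[->|us]; first by rewrite sc Gc.
rewrite leNgt; apply/negP => /ltW Gu.
by have := smin u; rewrite u0 (le_trans (ltW us))//= => /(_ isT Gu); rewrite leNgt us.
Qed.

(* Time reversal turns the last zero of g before a positive value into a first zero. *)
Lemma comparison (R : realType) (g : R -> R) (T : R) :
  continuous g -> g 0 <= 0 ->
  (forall t, 0 <= t < T -> g t = 0 ->
    exists2 D, (g (t + s) - g t) / s @[s --> 0^'+] --> D & D < 0) ->
  forall t, 0 <= t <= T -> g t <= 0.
Proof.
move=> cg g0 gD t1 /andP[t10 t1T]; rewrite leNgt; apply/negP => gt1.
have cG : continuous (fun s => - g (t1 - s)).
  move=> s; apply: continuousN; apply: (@continuous_comp _ _ _ (fun s => t1 - s) g).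
    by apply: continuousB; [exact: cst_continuous|exact: cvg_id].
  exact: cg.
have [||s [/andP[s0 st1] Gs Gneg]] := @first_zero R _ t1 cG t10.
- by rewrite subr0 oppr_lt0.
- by rewrite subrr oppr_ge0.
have gs : g (t1 - s) = 0 by rewrite -[LHS]opprK Gs oppr0.
have sp : 0 < s.
  rewrite lt_neqAle s0 andbT eq_sym; apply/eqP => sE.
  by move: gs gt1; rewrite sE subr0 => ->; rewrite ltxx.
have [|D gD' D0] := gD (t1 - s) _ gs.
  by rewrite subr_ge0 st1/= (lt_le_trans _ t1T)// ltrBlDr ltrDl.
(* On [[t1 - s, t1]] the function [g] is nonnegative and it vanishes at the left end, so its right
   difference quotients there are nonnegative. *)
suff : D >= 0 by rewrite leNgt D0.
apply: cvgr_to_ge gD' _; near=> u.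
have u0 : 0 < u by [].
have us : u <= s by near: u; apply: nbhs_right_le.
rewrite gs subr0 divr_ge0 ?(ltW u0)// -oppr_le0.
have -> : t1 - s + u = t1 - (s - u) by rewrite opprB addrA addrAC.
by apply: Gneg; rewrite subr_ge0 us lerBlDr lerDl ltW.
Unshelve. all: by end_near.
Qed.

(** * Integrals of continuous functions and Jensen's inequality *)

Section rint.
Variable R : realType.
Implicit Types (a b c : R) (f g : R -> R).

Lemma rint_integrable {a b f} : continuous f ->
  lebesgue_measure.-integrable `[a, b] (EFin \o f).
Proof.
move=> cf; apply: continuous_compact_integrable; first exact: segment_compact.
exact: continuous_subspaceT.
Qed.

Lemma rint_eq a b f g : (forall s, a <= s <= b -> f s = g s) ->
  rint a b f = rint a b g.
Proof.
by move=> fg; apply: eq_Rintegral => s; rewrite inE/= in_itv/=; exact: fg.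
Qed.

Lemma rint_cst a b c : a <= b -> rint a b (fun=> c) = (b - a) * c.
Proof.
move=> ab; rewrite /rint Rintegral_cst//= lebesgue_measure_itv/= mulrC.
rewrite lte_fin; case: ltP => //= ba.
have -> : a = b by apply/eqP; rewrite eq_le ab.
by rewrite subrr !mul0r.
Qed.

Lemma rintD a b f g : continuous f -> continuous g ->
  rint a b (fun s => f s + g s) = rint a b f + rint a b g.
Proof. by move=> cf cg; apply: RintegralD => //; exact: rint_integrable. Qed.

Lemma rintZ a b c f : continuous f ->
  rint a b (fun s => c * f s) = c * rint a b f.
Proof. by move=> cf; apply: RintegralZl => //; exact: rint_integrable. Qed.

Lemma rint_ge0 a b f : (forall s, a <= s <= b -> 0 <= f s) -> 0 <= rint a b f.
Proof. by move=> f0; apply: Rintegral_ge0 => s /=; rewrite in_itv/=; exact: f0. Qed.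

Lemma rint_le a b f g : continuous f -> continuous g ->
  (forall s, a <= s <= b -> f s <= g s) -> rint a b f <= rint a b g.
Proof.
move=> cf cg fg; by apply: le_Rintegral => //; exact: rint_integrable.
Qed.

Lemma rint_sum a b (I : eqType) (r : seq I) (F : I -> R -> R) :
  (forall i, continuous (F i)) ->
  rint a b (fun s => \sum_(i <- r) F i s) = \sum_(i <- r) rint a b (F i).
Proof.
move=> cF; elim: r => [|i r IH].
  rewrite big_nil (@rint_eq _ _ _ (fun=> 0 * 1)) => [|s _].
    by rewrite rintZ ?mul0r//; exact: cst_continuous.
  by rewrite big_nil mul0r.
rewrite big_cons -IH -rintD//.
  by apply: rint_eq => s _; rewrite big_cons.
elim: r {IH} => [|j r IH] t.
  by under eq_fun do rewrite big_nil; exact: cst_continuous.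
by under eq_fun do rewrite big_cons; apply: continuousD; [exact: cF|exact: IH].
Qed.

End rint.

(** The graph of a convex power lies above its tangents. This is Young's inequality for [s] and
    [t ^ (q - 1)] with the conjugate exponents [q] and [q / (q - 1)], which also covers [t = 0]. *)
Lemma powR_tangent (R : realType) (q s t : R) : 1 < q -> 0 <= s -> 0 <= t ->
  t `^ q + q * t `^ (q - 1) * (s - t) <= s `^ q.
Proof.
move=> q1 s0 t0.
have q0 : 0 < q by lra.
have qn : q != 0 by rewrite gt_eqF.
have qn1 : q - 1 != 0 by rewrite gt_eqF// subr_gt0.
have H := @conjugate_powR R s (t `^ (q - 1)) q (q / (q - 1)) s0 (powR_ge0 _ _) q0.
have {H} := H _ _; rewrite -powRrM mulrCA divff// mulr1.
have tq : t `^ (q - 1) * t = t `^ q.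
  by rewrite -{2}(powRr1 t0) -powRD subrK// (negbTE qn).
move=> /(_ _ _) H.
have {}H : s * t `^ (q - 1) <= s `^ q / q + t `^ q / (q / (q - 1)).
  apply: H; first by rewrite divr_gt0// subr_gt0.
  by rewrite invf_div; field.
rewrite -(ler_pM2l q0) in H.
have E : q * (s `^ q / q + t `^ q / (q / (q - 1))) = s `^ q + (q - 1) * t `^ q.
  by field; rewrite qn qn1.
rewrite E in H; rewrite -tq in H *; nra.
Qed.

(* Positivity of [f] matters: [x `^ p] is 1 for [x < 0]. *)
Lemma continuous_powR (R : realType) (T : topologicalType) (f : T -> R) (p : R) :
  continuous f -> (forall t, 0 <= f t) -> 0 < p ->
  continuous (fun t => f t `^ p).
Proof.
move=> cf f0 p0 t.
have := f0 t; rewrite le_eqVlt => /predU1P[ft|ft]; last first.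
  apply: (@continuous_comp _ _ _ f (fun z => z `^ p)); first exact: cf.
  apply/differentiable_continuous/derivable1_diffP.
  by apply: derivable_powR; rewrite in_itv/= ft.
(* At a zero of [f] the power need not be differentiable; continuity comes from [f s < e ^ (1 / p)]
   implying [f s ^ p < e]. *)
rewrite /continuous_at -ft powR0 ?gt_eqF//; apply/cvgrPdist_lt => e e0.
have e1 : 0 < e `^ p^-1 by rewrite powR_gt0.
have /cvgrPdist_lt/(_ _ e1) := cf t; apply: filterS => s.
rewrite -ft !sub0r !normrN (ger0_norm (f0 s)) ger0_norm ?powR_ge0// => fs.
have := @gt0_ltr_powR _ p p0 (f s) (e `^ p^-1).
rewrite !nnegrE f0 powR_ge0 fs -powRrM mulVf ?gt_eqF// powRr1 ?ltW//.
exact.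
Qed.

(** Jensen's inequality for a measure of total mass [1 + h]: the tangent inequality at the mean is
    integrated, and its linear terms cancel. *)
Lemma jensen_rint (R : realType) (q h A : R) (G : R -> R) :
  1 < q -> 0 <= h -> 0 <= A -> continuous G -> (forall s, 0 <= G s) ->
  (A + rint (- h) 0 G) `^ q
    <= (1 + h) `^ (q - 1) * (A `^ q + rint (- h) 0 (fun s => G s `^ q)).
Proof.
move=> q1 h0 A0 cG G0.
have h1 : 0 < 1 + h by rewrite ltr_pwDl.
have I0 : 0 <= rint (- h) 0 G by apply: rint_ge0 => s _.
set I := rint (- h) 0 G in I0 *.
(* Mean value for the measure with a unit atom added to Lebesgue's on [-h, 0]. *)
pose t := (A + I) / (1 + h).
have t0 : 0 <= t by rewrite divr_ge0 ?addr_ge0 ?(ltW h1).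
pose k := q * t `^ (q - 1).
have IG : h * (t `^ q - k * t) + k * I <= rint (- h) 0 (fun s => G s `^ q).
  have -> : h * (t `^ q - k * t) + k * I
      = rint (- h) 0 (fun s => (t `^ q - k * t) + k * G s).
    rewrite rintD ?rintZ ?rint_cst ?opprK ?add0r ?oppr_le0//.
    - exact: cst_continuous.
    - by move=> s; apply: cvgM; [exact: cvg_cst|exact: cG].
  apply: rint_le.
  - move=> s; apply: cvgD; first exact: cvg_cst.
    by apply: cvgM; [exact: cvg_cst|exact: cG].
  - by apply: continuous_powR => //; apply: lt_trans q1.
  - by move=> s _; have := powR_tangent q1 (G0 s) t0; rewrite -/k; lra.
have IA : t `^ q + k * (A - t) <= A `^ q by exact: powR_tangent.
have tE : (1 + h) * t = A + I by rewrite /t mulrC divfK ?gt_eqF.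
have -> : (A + I) `^ q = (1 + h) `^ (q - 1) * ((1 + h) * t `^ q).
  rewrite -tE powRM ?(ltW h1)// mulrA; congr (_ * _).
  rewrite -{3}(powRr1 (ltW h1)) -powRD subrK//.
  by rewrite gt_eqF// (lt_trans _ q1).
rewrite ler_pM2l ?powR_gt0//.
(* The cancellation of the linear terms in the sum of [IA] and [IG]. *)
have : k * ((1 + h) * t) = k * (A + I) by rewrite tE.
nra.
Qed.

(** The origin of the constant rho. It is applied with [A] and [G] the [gamma]-th powers of the
    norms of the present and past values of x, and [q = (gamma + mu - 1) / gamma]; then (L3) bounds
    [v], and the right-hand side is the dissipation in (L1) without its [c1] term. *)
Lemma dissipation_bound (R : realType) (q h A v b0 b1 c0 c2 : R) (G : R -> R) :
  let b := Num.max b0 b1 in let c := Num.min c0 c2 in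
  1 < q -> 0 <= h -> 0 <= A -> 0 < b0 -> 0 < b1 -> 0 < c0 -> 0 < c2 ->
  continuous G -> (forall s, 0 <= G s) ->
  0 <= v -> v <= b0 * A + b1 * rint (- h) 0 G ->
  c / (b `^ q * (2 * Num.max 1 h) `^ (q - 1)) * v `^ q
    <= c0 * A `^ q + c2 * rint (- h) 0 (fun s => G s `^ q).
Proof.
move=> b c q1 h0 A0 b00 b10 c00 c20 cG G0 v0 vle.
have J := jensen_rint q1 h0 A0 cG G0.
have I0 : 0 <= rint (- h) 0 G by apply: rint_ge0 => s _.
have Iq0 : 0 <= rint (- h) 0 (fun s => G s `^ q).
  by apply: rint_ge0 => s _; exact: powR_ge0.
set I := rint _ _ G in J I0 vle *.
set Iq := rint _ _ _ in J Iq0 *.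
have q0 : 0 < q by apply: lt_trans q1.
have bp : 0 < b by rewrite lt_max b00.
have cp : 0 < c by rewrite lt_min c00.
have mp : 0 < 2 * Num.max 1 h by rewrite mulr_gt0// lt_max ltr01.
have bA : b0 * A <= b * A by rewrite ler_wpM2r// le_max lexx.
have bI : b1 * I <= b * I by rewrite ler_wpM2r// le_max lexx orbT.
have vq : v `^ q <= (b * (A + I)) `^ q.
  by rewrite ge0_ler_powR ?nnegrE ?(ltW q0)// ?mulr_ge0 ?addr_ge0 ?(ltW bp)//; lra.
(* The mass [1 + h] from Jensen's inequality is replaced by the larger [2 * Num.max 1 h] of the
   stated rate. *)
have hq : (1 + h) `^ (q - 1) <= (2 * Num.max 1 h) `^ (q - 1).
  rewrite ge0_ler_powR ?nnegrE ?(ltW mp)//; try lra.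
  have : 1 <= Num.max 1 h by rewrite le_max lexx.
  have : h <= Num.max 1 h by rewrite le_max lexx orbT.
  by lra.
have cA : c * A `^ q <= c0 * A `^ q.
  by rewrite ler_wpM2r ?powR_ge0// ge_min lexx.
have cI : c * Iq <= c2 * Iq by rewrite ler_wpM2r// ge_min lexx orbT.
apply: (@le_trans _ _ (c * (A `^ q + Iq))); last by lra.
rewrite -mulrA ler_pM2l// ler_pdivrMl ?mulr_gt0 ?powR_gt0//.
apply: le_trans vq _; rewrite powRM ?(ltW bp) ?addr_ge0//.
rewrite -mulrA ler_pM2l ?powR_gt0//; apply: le_trans J _.
by rewrite ler_wpM2r// addr_ge0// powR_ge0.
Qed.

Lemma is_derive_right (R : realType) (f : R -> R) (t D : R) :
  is_derive t 1 f D -> (f (t + s) - f t) / s @[s --> 0^'+] --> D.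
Proof.
move=> [df <-]; apply: cvg_dnbhs_at_right.
rewrite (_ : (fun s => _) = fun s => s^-1 *: ((f \o shift t) (s *: (1 : R)) - f t)).
  exact: df.
by apply/funext => s; rewrite mulrC [t + s]addrC /= [_ *: 1]mulr1.
Qed.

(** * Decay of scalar trajectories *)

Section profile.
Variable R : realType.
Implicit Types (d p w t : R).

(* The absolute value only serves to make profiles continuous on the whole line. *)
Definition profile d p w t : R := (w + d * `|t|) `^ (- p).

Lemma profile_arg_gt0 d w t : 0 <= d -> 0 < w -> 0 < w + d * `|t|.
Proof. by move=> d0 w0; rewrite ltr_wpDr// mulr_ge0. Qed.

Lemma profile_gt0 d p w t : 0 <= d -> 0 < w -> 0 < profile d p w t.
Proof. by move=> d0 w0; rewrite powR_gt0// profile_arg_gt0. Qed.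

Lemma profile0 d p w : profile d p w 0 = w `^ (- p).
Proof. by rewrite /profile normr0 mulr0 addr0. Qed.

Lemma ler_powRN (p x y : R) : 0 <= p -> 0 < x -> x <= y ->
  y `^ (- p) <= x `^ (- p).
Proof.
move=> p0 x0 xy; have y0 := lt_le_trans x0 xy.
by rewrite !powRN lef_pV2 ?posrE ?powR_gt0// ge0_ler_powR ?nnegrE// ltW.
Qed.

Lemma ltr_powRN (p x y : R) : 0 < p -> 0 < x -> x < y ->
  y `^ (- p) < x `^ (- p).
Proof.
move=> p0 x0 xy; have y0 := lt_trans x0 xy.
by rewrite !powRN ltf_pV2 ?posrE ?powR_gt0// gt0_ltr_powR ?nnegrE// ltW.
Qed.

Lemma continuous_profile d p w : 0 <= d -> 0 < w -> continuous (profile d p w).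
Proof.
move=> d0 w0 t.
apply: (@continuous_comp _ _ _ (fun t => w + d * `|t|) (fun z => z `^ (- p))).
  apply: cvgD; first exact: cvg_cst.
  by apply: cvgM; [exact: cvg_cst|exact: norm_continuous].
apply/differentiable_continuous/derivable1_diffP.
by apply: derivable_powR; rewrite in_itv/= profile_arg_gt0.
Qed.

(** With [p = 1 / kappa] and [d = rho' * kappa] the limit is [- rho' * u ^ (1 + kappa)], [u] being
    the value of the profile at [t]. The derivative is one-sided because of the kink of the absolute
    value at 0. *)
Lemma profile_right_derivative d p w t : 0 <= d -> 0 < w -> 0 <= t ->
  (profile d p w (t + s) - profile d p w t) / s @[s --> 0^'+]
    --> - (d * p * (w + d * t) `^ (- p - 1)).
Proof.
move=> d0 w0 t0.
have D : is_derive t 1 (fun u => (w + d * u) `^ (- p))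
    (- (d * p * (w + d * t) `^ (- p - 1))).
  have wt : 0 < w + d * t by rewrite ltr_wpDr// mulr_ge0.
  have D1 : is_derive t (1 : R) (fun u => w + d * u) d.
    by apply: is_derive_eq; rewrite add0r mul1r [d%:A]mulr1.
  have D2 := is_derive1_powR (- p) wt.
  have := @is_derive1_comp _ (fun z => z `^ (- p)) (fun u => w + d * u) _ _ _ D2 D1.
  by move=> D3; apply: is_derive_eq D3 _; ring.
apply: cvg_trans (is_derive_right D); apply: near_eq_cvg; near=> s.
have s0 : 0 < s by [].
by rewrite /profile !ger0_norm// addr_ge0// ltW.
Unshelve. all: by end_near.
Qed.

End profile.

(** The bootstrap in scalar form: [y] stands for the norm of x and [v] for the functional along x.
    Two radii are used: [v] is compared with the profile issued from [r0], and [y] with the one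
    issued from [r]. The strict gap between the profiles excludes a first contact. *)
Lemma scalar_decay (R : realType) (h kappa gamma alpha delta Delta a1 K rho rho' : R)
    (y v : R -> R) (r0 r : R) :
  0 < h -> 0 < kappa -> 0 < gamma -> 0 < alpha -> 0 < delta -> 0 < a1 -> a1 <= K ->
  0 < r0 -> r0 < r -> r <= Delta ->
  K * Delta `^ gamma <= a1 * delta `^ gamma ->
  0 < rho' -> rho' < rho ->
  1 + rho' * kappa * h * (K * r `^ gamma) `^ kappa <= alpha `^ (gamma * kappa) ->
  continuous y -> continuous v -> (forall t, 0 <= y t) ->
  (forall s : R, - h <= s <= 0 -> y s <= r0) ->
  v 0 <= K * r0 `^ gamma ->
  (forall t : R, 0 <= t -> (forall s : R, - h <= s <= 0 -> y (t + s) <= delta) ->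
    0 <= v t ->
    rderiv_le v t (- (rho * v t `^ (1 + kappa)))) ->
  (forall t : R, 0 <= t -> (forall s : R, - h <= s <= 0 -> y (t + s) <= delta) ->
    (forall s : R, - h <= s <= 0 -> y (t + s) <= alpha * y t) ->
    a1 * y t `^ gamma <= v t) ->
  forall t : R, 0 <= t ->
    a1 * y t `^ gamma
      <= profile (rho' * kappa) kappa^-1 ((K * r `^ gamma) `^ (- kappa)) t.
Proof.
move=> h0 k0 g0 al0 de0 a10 aK r00 r0r rD KD rho'0 rho'rho Hal cy cv y0 yr v0 L13 L2 t1 t10.
have K0 : 0 < K by apply: lt_le_trans aK.
have rp : 0 < r by apply: lt_trans r0r.
pose d := rho' * kappa; pose p := kappa^-1.
have d0 : 0 <= d by rewrite mulr_ge0 ?ltW.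
have p0 : 0 < p by rewrite invr_gt0.
(* Chosen so that the profile with parameter [W s] starts at [K * s ^ gamma]. *)
pose W s := (K * s `^ gamma) `^ (- kappa).
have W0 (s : R) : 0 < s -> 0 < W s by move=> s0; rewrite powR_gt0// mulr_gt0// powR_gt0.
have WE (s : R) : 0 < s -> W s `^ (- p) = K * s `^ gamma.
  move=> s0; rewrite -powRrM mulrNN mulfV ?gt_eqF// powRr1//.
  by rewrite mulr_ge0 ?powR_ge0// ltW.
have gr (u s : R) : 0 <= u -> u <= s -> u `^ gamma <= s `^ gamma.
  by move=> u0 us; rewrite ge0_ler_powR ?nnegrE ?(ltW g0)// (le_trans u0).
have gr' (u s : R) : 0 <= u -> 0 <= s -> u `^ gamma <= s `^ gamma -> u <= s.
  move=> u0 s0; apply: contraTT; rewrite -!ltNge => su.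
  by rewrite gt0_ltr_powR ?nnegrE.
have grs : r0 `^ gamma < r `^ gamma by rewrite gt0_ltr_powR ?nnegrE// ltW.
have Wlt : W r < W r0.
  by apply: ltr_powRN => //; rewrite ?mulr_gt0 ?powR_gt0// ltr_pM2l.
rewrite leNgt; apply/negP => Hexit.
pose U s := profile d p (W s).
have U0 (s : R) : 0 < s -> U s 0 = K * s `^ gamma by move=> s0; rewrite /U profile0 WE.
have Uanti (s u w : R) : 0 < s -> 0 <= u -> u <= w -> U s w <= U s u.
  move=> s0 u0 uw; apply: ler_powRN; rewrite ?(ltW p0)//.
    by apply: profile_arg_gt0; rewrite ?W0.
  by rewrite lerD2l ler_wpM2l// !ger0_norm// (le_trans u0).
have [|||s [/andP[s0 st1] Gs Gneg]] :=
  @first_zero R (fun t => a1 * y t `^ gamma - U r t) t1 _ t10.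
- move=> t; apply: cvgB; last by apply: continuous_profile; rewrite ?W0.
  by apply: cvgM; [exact: cvg_cst|exact: continuous_powR].
(* There is no contact at time 0, because [a1 <= K], [y 0 <= r0] and [r0 < r]. *)
- rewrite U0// subr_lt0.
  have : a1 * y 0 `^ gamma <= K * r0 `^ gamma.
    by rewrite ler_pM ?powR_ge0 ?(ltW a10)// gr// yr// lexx oppr_le0 ltW.
  by move=> /le_lt_trans; apply; rewrite ltr_pM2l.
- by rewrite subr_ge0 ltW.
have ays : a1 * y s `^ gamma = U r s by apply/eqP; rewrite -subr_eq0 Gs.
(* At negative times the initial history is bounded by the starting value of the profile, hence the
   maximum with 0. *)
have past (u th : R) : 0 <= u <= s -> - h <= th <= 0 ->
    a1 * y (u + th) `^ gamma <= U r (Num.max (u + th) 0).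
  move=> /andP[u0 us] /andP[th0 th1]; case: (leP 0 (u + th)) => uth.
    by rewrite -subr_le0 Gneg// uth/= (le_trans _ us)// gerDl.
  rewrite U0// ler_pM ?powR_ge0 ?(ltW a10)//; apply: le_trans (ltW grs).
  rewrite gr// yr// (ltW uth) andbT; apply: le_trans th0 _.
  by rewrite lerDr.
have small (u : R) : 0 <= u <= s -> forall th : R, - h <= th <= 0 -> y (u + th) <= delta.
  move=> us th thh; apply: gr'; rewrite ?(ltW de0)// -(ler_pM2l a10).
  apply: le_trans (past _ _ us thh) _; apply: le_trans KD.
  apply: le_trans (Uanti r 0 _ rp _ _) _; rewrite ?le_max ?lexx ?orbT//.
  by rewrite U0// ler_pM2l// gr// ltW.
(* Where [v] meets the profile it is positive, and it decreases strictly faster since [rho' < rho]: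
   this is the sign condition of [comparison]. *)
have vU : v s - U r0 s <= 0.
  apply: (@comparison R (fun t => v t - U r0 t) s); last by rewrite s0 lexx.
  - move=> t; apply: cvgB; first exact: cv.
    by apply: continuous_profile; rewrite ?W0.
  - by rewrite U0// subr_le0.
  move=> t /andP[t0 ts] /eqP; rewrite subr_eq0 => /eqP vt.
  have vtp : 0 < v t by rewrite vt profile_gt0// W0.
  have [|D [vD Dle]] := L13 t t0 _ (ltW vtp).
    by move=> th; apply: small; rewrite t0 ltW.
  have UD := @profile_right_derivative R d p _ _ d0 (W0 _ r00) t0.
  exists (D - - (d * p * (W r0 + d * t) `^ (- p - 1))).
    rewrite (_ : (fun _ => _) = (fun u => (v (t + u) - v t) / u
      - (U r0 (t + u) - U r0 t) / u)); first exact: cvgB vD UD.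
    by apply/funext => u; rewrite -mulrBl; congr (_ / _); ring.
  have -> : d * p = rho' by rewrite /d /p mulfK// gt_eqF.
  have -> : (W r0 + d * t) `^ (- p - 1) = v t `^ (1 + kappa).
    rewrite vt /U /profile ger0_norm// -powRrM; congr powR.
    by rewrite /p; field; rewrite gt_eqF.
  rewrite opprK -ltrBrDr sub0r; apply: le_lt_trans Dle _.
  by rewrite ltrN2 ltr_pM2r// powR_gt0.
(* At the contact time [a1 * y s ^ gamma] equals the profile, so it suffices to bound the ratio of
   the profile at [u] to its value at [s], where [u = max (s + th) 0] and [s <= u + h]. *)
have sal (th : R) : - h <= th <= 0 -> y (s + th) <= alpha * y s.
  move=> thh; apply: gr' => //; first by rewrite mulr_ge0// ltW.
  rewrite powRM ?(ltW al0)// -(ler_pM2l a10) mulrCA ays.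
  apply: le_trans (past _ _ _ thh) _; first by rewrite s0 lexx.
  set u := Num.max _ _.
  have u0 : 0 <= u by rewrite le_max lexx orbT.
  have /andP[th0 th1] := thh.
  have su : s <= u + h by rewrite -lerBlDr le_max lerD2l th0.
  have us : u <= s by rewrite ge_max s0 andbT gerDl.
  rewrite /U /profile !ger0_norm//.
  have wu : 0 < W r + d * u by rewrite ltr_wpDr ?W0// mulr_ge0.
  have ws : 0 < W r + d * s by rewrite ltr_wpDr ?W0// mulr_ge0.
  (* The hypothesis [Hal] reads [1 + d * h / W r <= alpha ^ (gamma * kappa)], which is the case
     [u = 0], [s = h]; larger [u] only helps. *)
  have key : W r + d * s <= alpha `^ (gamma * kappa) * (W r + d * u).
    have WV : (K * r `^ gamma) `^ kappa = (W r)^-1 by rewrite /W powRN invrK.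
    have al1 : W r + d * h <= alpha `^ (gamma * kappa) * W r.
      rewrite -ler_pdivrMr ?W0//; apply: le_trans Hal; rewrite WV.
      by rewrite mulrDl divff ?gt_eqF ?W0//.
    have al2 : 1 <= alpha `^ (gamma * kappa).
      apply: le_trans Hal; rewrite lerDl mulr_ge0 ?powR_ge0//.
      by rewrite mulr_ge0 ?(ltW h0).
    have : d * s <= d * u + d * h by rewrite -mulrDr ler_wpM2l.
    rewrite mulrDr -(lerD2l (W r)) => /le_trans; apply.
    by rewrite addrCA addrC lerD// ler_peMl// mulr_ge0.
  rewrite !powRN ler_pdivlMr ?powR_gt0// mulrC ler_pdivrMr ?powR_gt0//.
  have -> : alpha `^ gamma = (alpha `^ (gamma * kappa)) `^ p.
    by rewrite -powRrM /p mulfK// gt_eqF.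
  rewrite -powRM ?powR_ge0 ?(ltW wu)//.
  by rewrite ge0_ler_powR ?nnegrE ?(ltW p0) ?(ltW ws)// mulr_ge0 ?powR_ge0 ?(ltW wu).
(* Contradiction: [U r s = a1 * y s ^ gamma <= v s <= U r0 s < U r s]. *)
have := L2 s s0 (small s _) sal; rewrite s0 lexx => /(_ isT).
rewrite ays leNgt => /negP; apply.
apply: (@le_lt_trans _ _ (U r0 s)); first by rewrite -subr_le0.
apply: ltr_powRN p0 (profile_arg_gt0 s d0 (W0 _ rp)) _.
by rewrite ltrD2r.
Qed.

(** * Euclidean norm and continuity *)

Section euclidean.
Variables (R : realType) (n : nat).
Implicit Types (x y z : 'cV[R]_n) (A : 'M[R]_n).

Lemma enorm_ge0 x : 0 <= enorm x.
Proof. exact: sqrtr_ge0. Qed.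

Lemma sqr_enorm x : enorm x ^+ 2 = \sum_(i < n) x i ord0 ^+ 2.
Proof. by rewrite sqr_sqrtr// sumr_ge0// => i _; exact: sqr_ge0. Qed.

Lemma enorm_eq0 x : enorm x = 0 -> x = 0.
Proof.
move=> x0; have /eqP := sqr_enorm x.
rewrite x0 expr0n/= eq_sym psumr_eq0 => [/allP xi|i _]; last exact: sqr_ge0.
apply/matrixP => i j; rewrite (ord1 j) mxE; apply/eqP.
by have := xi i; rewrite mem_index_enum sqrf_eq0 => /(_ isT).
Qed.

Lemma enorm0 : enorm (0 : 'cV[R]_n) = 0.
Proof.
by rewrite /enorm big1 ?sqrtr0// => i _; rewrite mxE expr0n.
Qed.

(** Cauchy-Schwarz, by expanding the squared norm of [|y| x - |x| y], which is
    [2 |x| |y| (|x| |y| - x.y)]. *)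
Lemma dotv_le x y : dotv x y <= enorm x * enorm y.
Proof.
have [/enorm_eq0 ->|x0] := eqVneq (enorm x) 0.
  rewrite enorm0 mul0r /dotv big1// => i _; by rewrite mxE mul0r.
have [/enorm_eq0 ->|y0] := eqVneq (enorm y) 0.
  rewrite enorm0 mulr0 /dotv big1// => i _; by rewrite mxE mulr0.
have xp : 0 < enorm x by rewrite lt_neqAle eq_sym x0 enorm_ge0.
have yp : 0 < enorm y by rewrite lt_neqAle eq_sym y0 enorm_ge0.
have : 0 <= \sum_(i < n) (enorm y * x i ord0 - enorm x * y i ord0) ^+ 2.
  by rewrite sumr_ge0// => i _; exact: sqr_ge0.
have -> : \sum_(i < n) (enorm y * x i ord0 - enorm x * y i ord0) ^+ 2 =
    2 * (enorm x * enorm y) * (enorm x * enorm y - dotv x y).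
  transitivity (enorm y ^+ 2 * enorm x ^+ 2 + enorm x ^+ 2 * enorm y ^+ 2
      - 2 * (enorm x * enorm y) * dotv x y); last by ring.
  rewrite {1}(sqr_enorm x) {2}(sqr_enorm y) /dotv !mulr_sumr -big_split/= -sumrB.
  by apply: eq_bigr => i _; ring.
by rewrite pmulr_rge0 ?subr_ge0// !mulr_gt0.
Qed.

Lemma dotvv x : dotv x x = enorm x ^+ 2.
Proof. by rewrite sqr_enorm; apply: eq_bigr => i _; rewrite expr2. Qed.

Lemma dotvC x y : dotv x y = dotv y x.
Proof. by apply: eq_bigr => i _; rewrite mulrC. Qed.

Lemma dotvDr x y z : dotv x (y + z) = dotv x y + dotv x z.
Proof. by rewrite /dotv -big_split/=; apply: eq_bigr => i _; rewrite mxE mulrDr. Qed.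

Lemma dotvNr x y : dotv x (- y) = - dotv x y.
Proof. by rewrite /dotv -sumrN; apply: eq_bigr => i _; rewrite mxE mulrN. Qed.

Lemma dotvZr x (c : R) y : dotv x (c *: y) = c * dotv x y.
Proof. by rewrite /dotv mulr_sumr; apply: eq_bigr => i _; rewrite mxE mulrCA. Qed.

Lemma enormZ (c : R) x : enorm (c *: x) = `|c| * enorm x.
Proof.
rewrite /enorm -sqrtr_sqr -sqrtrM ?sqr_ge0// mulr_sumr.
by congr Num.sqrt; apply: eq_bigr => i _; rewrite mxE exprMn.
Qed.

Lemma enormN x : enorm (- x) = enorm x.
Proof. by rewrite -scaleN1r enormZ normrN normr1 mul1r. Qed.

Lemma enormD x y : enorm (x + y) <= enorm x + enorm y.
Proof.
have xy0 : 0 <= enorm x + enorm y by rewrite addr_ge0 ?enorm_ge0.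
rewrite -(ler_pXn2r (ltn0Sn 1)) ?nnegrE ?enorm_ge0//.
have := dotv_le x y; rewrite -dotvv dotvDr.
rewrite !(dotvC (x + y)) !dotvDr !dotvv (dotvC y x); nra.
Qed.

(** The Frobenius norm serves as [C], by Cauchy-Schwarz on each row. It bounds the set whose
    supremum is [mnorm A]. *)
Lemma mulmx_enorm_bounded A : exists2 C, 0 <= C &
  forall u, enorm (A *m u) <= C * enorm u.
Proof.
pose C := Num.sqrt (\sum_i enorm (\col_j A i j) ^+ 2).
exists C => [|u]; first exact: sqrtr_ge0.
have C0 : 0 <= C by exact: sqrtr_ge0.
rewrite -(ler_pXn2r (ltn0Sn 1)) ?nnegrE ?mulr_ge0 ?enorm_ge0// exprMn.
rewrite sqr_enorm sqr_sqrtr ?sumr_ge0// => [|i _]; last exact: sqr_ge0.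
rewrite mulr_suml; apply: ler_sum => i _.
have -> : (A *m u) i ord0 = dotv (\col_j A i j) u.
  by rewrite mxE; apply: eq_bigr => j _; rewrite mxE.
rewrite -exprMn -[leLHS]real_normK ?num_real//.
rewrite (ler_pXn2r (ltn0Sn 1)) ?nnegrE ?mulr_ge0 ?enorm_ge0// ler_norml.
rewrite dotv_le andbT lerNl -dotvNr; apply: le_trans (dotv_le _ _) _.
by rewrite enormN.
Qed.

Lemma mulmx_mnorm A u : enorm (A *m u) <= mnorm A * enorm u.
Proof.
have [C C0 AC] := mulmx_enorm_bounded A.
have [u0|u0] := eqVneq (enorm u) 0.
  by have := AC u; rewrite u0 !mulr0.
have up : 0 < enorm u by rewrite lt_neqAle eq_sym u0 enorm_ge0.
rewrite -ler_pdivrMr//; apply: ub_le_sup.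
  exists C => _ [w /= w1 <-]; apply: le_trans (AC w) _.
  by rewrite ler_piMr.
exists ((enorm u)^-1 *: u) => /=.
  by rewrite enormZ ger0_norm ?invr_ge0 ?enorm_ge0// mulVf.
by rewrite -scalemxAr enormZ ger0_norm ?invr_ge0 ?enorm_ge0// mulrC.
Qed.

Lemma mnorm_le A (C : R) : (forall u, enorm u <= 1 -> enorm (A *m u) <= C) ->
  mnorm A <= C.
Proof.
move=> AC; apply: ge_sup.
  by exists (enorm (A *m 0)), 0 => //=; rewrite enorm0.
by move=> _ [u /= u1 <-]; exact: AC.
Qed.

Lemma mnorm_ge0 A : 0 <= mnorm A.
Proof.
have [C C0 AC] := mulmx_enorm_bounded A.
apply: ub_le_sup.
  exists C => _ [w /= w1 <-]; apply: le_trans (AC w) _.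
  by rewrite ler_piMr.
by exists 0; rewrite /= ?mulmx0 enorm0.
Qed.

End euclidean.

Section continuity.
Variable R : realType.

Lemma continuous_sum (T : topologicalType) (I : eqType) (r : seq I) (F : I -> T -> R) :
  (forall i, continuous (F i)) -> continuous (fun t => \sum_(i <- r) F i t).
Proof.
move=> cF; elim: r => [|j r IH] t.
  by under eq_fun do rewrite big_nil; exact: cst_continuous.
by under eq_fun do rewrite big_cons; apply: cvgD; [exact: cF|exact: IH].
Qed.

Lemma continuous_coord (T : topologicalType) m k (F : T -> 'M[R]_(m, k)) i j :
  continuous F -> continuous (fun t => F t i j).
Proof.
move=> cF t; apply: (@continuous_comp _ _ _ F (fun M => M i j)); first exact: cF.
exact: coord_continuous.
Qed.

Lemma continuous_enorm (T : topologicalType) n (F : T -> 'cV[R]_n) :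
  continuous F -> continuous (fun t => enorm (F t)).
Proof.
move=> cF t.
apply: (@continuous_comp _ _ _ (fun t => \sum_(i < n) F t i ord0 ^+ 2) Num.sqrt);
  last exact: sqrt_continuous.
apply: continuous_sum => i s; have := @continuous_coord _ _ _ F i ord0 cF s.
by move=> c; under eq_fun do rewrite expr2; exact: cvgM.
Qed.

Lemma continuous_pair (T U W : topologicalType) (f : T -> U) (g : T -> W) :
  continuous f -> continuous g -> continuous (fun t => (f t, g t)).
Proof. by move=> cf cg t; exact: cvg_pair (cf t) (cg t). Qed.

(** Dominated convergence; the dominating constant is a bound of [F] on the compact rectangle
    [[t - 1, t + 1]] times [[a, b]]. *)
Lemma continuous_rint_param (F : R * R -> R) (a b : R) : continuous F ->
  continuous (fun t => rint a b (fun s => F (t, s))).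
Proof.
move=> cF t.
have [M MF] : exists M, forall u s, t - 1 <= u <= t + 1 -> a <= s <= b ->
    `|F (u, s)| <= M.
  have cK : compact (`[t - 1, t + 1] `*` `[a, b]).
    by apply: compact_setX; exact: segment_compact.
  have /compact_bounded[M [_ MF]] :=
    continuous_compact (continuous_subspaceT cF) cK.
  exists (M + 1) => u s ut sab; apply: (MF (M + 1)); first by rewrite ltrDl.
  by exists (u, s) => //; split => /=; rewrite in_itv/=.
have cFt u : continuous (fun s => F (u, s)).
  move=> s; apply: (@continuous_comp _ _ _ (fun s => (u, s)) F); last exact: cF.
  by apply: continuous_pair => z; [exact: cvg_cst|exact: cvg_id].
apply: (@continuity_under_integral R _ _ lebesgue_measure (fun u s => F (u, s))
  `[a, b] _ (t - 1) (t + 1) _ _ (fun=> M)).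
- exact: measurable_itv.
- by move=> u _; apply: rint_integrable; exact: cFt.
- apply: aeW => s _ u _.
  apply: (@continuous_comp _ _ _ (fun u => (u, s)) F); last exact: cF.
  by apply: continuous_pair => z; [exact: cvg_id|exact: cvg_cst].
- by apply: rint_integrable; exact: cst_continuous.
- move=> u; rewrite /= in_itv/= => /andP[ut tu]; apply: aeW => s /=.
  by rewrite in_itv/= => sab; apply: MF => //; rewrite !ltW.
- by rewrite inE/= in_itv/=; apply/andP; split; lra.
Qed.

Lemma continuous_rint_upper (g : R -> R) (T : R) : continuous g -> 0 < T ->
  {for T, continuous (fun T => rint 0 T g)}.
Proof.
move=> cg T0.
have T1 : 0 <= T + 1 by rewrite addr_ge0// ltW.
have := parameterized_integral_continuous T1 (rint_integrable cg).
move=> /continuous_within_itvP[|+ _ _]; first by rewrite ltr_wpDl// ltW.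
by apply; rewrite in_itv/= T0 ltrDl ltr01.
Qed.

(** Constant extension to the left of [a]. It turns B and x, continuous on half-lines only, into
    functions continuous on the whole line. *)
Lemma continuous_clamp (T : topologicalType) (a : R) (f : R -> T) :
  {within `[a, +oo[, continuous f} -> continuous (fun t => f (Num.max t a)).
Proof.
move=> /subspace_continuousP cf t.
have ta : [set` `[a, +oo[] (Num.max t a) by rewrite /= in_itv/= andbT le_max lexx orbT.
apply: (@cvg_comp _ _ _ (fun t => Num.max t a) f) (cf _ ta) => A [e /= e0 Ae].
have cmax : continuous (fun t : R => Num.max t a).
  by move=> s; apply: continuous_max; [exact: cvg_id|exact: cvg_cst].
have /cvgrPdist_lt/(_ _ e0) := cmax t.
apply: filterS => s se; apply: Ae => //=.
by rewrite in_itv/= andbT le_max lexx orbT.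
Qed.

End continuity.

(** * The functional v *)

Section functional.
Variables (R : realType) (n : nat).
Implicit Types (phi : R -> 'cV[R]_n) (B : R -> 'M[R]_n).

Lemma enorm_le_normh (h th : R) phi : isC h phi -> - h <= th <= 0 ->
  enorm (phi th) <= normh h phi.
Proof.
move=> cphi thh; apply: ub_le_sup; last by exists th => //=; rewrite in_itv/=.
have cN : {within `[- h, 0], continuous (fun s => enorm (phi s))}.
  exact: continuous_enorm.
have /compact_bounded[M [_ MF]] :=
  continuous_compact cN (@segment_compact _ (- h) 0).
exists (M + 1) => _ [s /= sh <-]; apply: le_trans (ler_norm _) _.
by apply: (MF (M + 1)); [rewrite ltrDl|exists s].
Qed.

Lemma normh_le (h C : R) phi : 0 <= h ->
  (forall th, - h <= th <= 0 -> enorm (phi th) <= C) -> normh h phi <= C.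
Proof.
move=> h0 phiC; apply: ge_sup; last first.
  by move=> y [th /=]; rewrite in_itv/= => /phiC + <-.
by exists (enorm (phi 0)), 0 => //=; rewrite in_itv/= lexx oppr_le0 h0.
Qed.

Lemma continuous_dotv (T : topologicalType) (u v : T -> 'cV[R]_n) :
  (forall i, continuous (fun t => u t i ord0)) ->
  (forall i, continuous (fun t => v t i ord0)) ->
  continuous (fun t => dotv (u t) (v t)).
Proof.
by move=> cu cv; apply: continuous_sum => i t; apply: cvgM; [exact: cu|exact: cv].
Qed.

Lemma dotv_vint (a b : R) z (F : R -> 'cV[R]_n) :
  (forall i, continuous (fun s => F s i ord0)) ->
  dotv z (vint a b F) = rint a b (fun s => dotv z (F s)).
Proof.
move=> cF; rewrite /dotv rint_sum => [|i s].
  by apply: eq_bigr => i _; rewrite mxE rintZ.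
by apply: cvgM; [exact: cvg_cst|exact: cF].
Qed.

Lemma mulmx_coord_continuous (T : topologicalType) (A : T -> 'M[R]_n)
    (u : T -> 'cV[R]_n) i :
  (forall j, continuous (fun t => A t i j)) -> continuous u ->
  continuous (fun t => (A t *m u t) i ord0).
Proof.
move=> cA cu.
under eq_fun do rewrite mxE.
apply: continuous_sum => j t; apply: cvgM; first exact: cA.
exact: continuous_coord.
Qed.

Lemma continuous_expR_decay (eps T : R) :
  continuous (fun s => expR (- (eps * (T - s)))).
Proof.
move=> s; apply: (@continuous_comp _ _ _ (fun s => - (eps * (T - s))) expR);
  last exact: continuous_expR.
apply: cvgN; apply: cvgM; first exact: cvg_cst.
by apply: cvgB; [exact: cvg_cst|exact: cvg_id].
Qed.

(** Reduces the estimate of the matrix L to integrals of vectors, and so of scalars. *)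
Lemma Lmat_mul B (h eps t : R) u : continuous B ->
  Lmat B h eps t *m u
    = vint 0 (t + h) (fun s => expR (- (eps * (t + h - s))) *: (B s *m u)).
Proof.
move=> cB; apply/matrixP => i j; rewrite (ord1 j) !mxE.
under [RHS]rint_eq do rewrite 2!mxE mulr_sumr.
rewrite rint_sum; last first.
  move=> k s; apply: cvgM; first exact: continuous_expR_decay.
  by apply: cvgM; [exact: continuous_coord|exact: cvg_cst].
apply: eq_bigr => k _; rewrite mxE mulrC -rintZ => [|s].
  by apply: rint_eq => s _; rewrite mxE; ring.
by under eq_fun do rewrite mxE; apply: cvgM;
  [exact: continuous_expR_decay|exact: continuous_coord].
Qed.

Lemma rint_expR_le (eps T : R) : 0 < eps -> 0 < T ->
  rint 0 T (fun s => expR (- (eps * (T - s)))) <= eps^-1.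
Proof.
move=> e0 T0; pose F s := eps^-1 * expR (- (eps * (T - s))).
have dF s : is_derive s (1 : R) F (expR (- (eps * (T - s)))).
  have D1 : is_derive s (1 : R) (fun s => - (eps * (T - s))) eps.
    by apply: is_derive_eq; rewrite add0r mul1r [_ *: _]mulrN1 opprK.
  have D2 := @is_derive1_comp _ expR (fun s => - (eps * (T - s))) _ _ _ (is_derive_expR _) D1.
  apply: is_derive_eq.
  by rewrite [_ *: _]mulrC mulfK ?gt_eqF.
have cF s : {for s, continuous F}.
  by apply/differentiable_continuous/derivable1_diffP; apply: ex_derive.
rewrite /rint /Rintegral (@continuous_FTC2 _ _ F)//.
- rewrite -EFinB/= /F subrr mulr0 oppr0 expR0 mulr1 lerBlDr lerDl.
  by rewrite mulr_ge0 ?expR_ge0// invr_ge0 ltW.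
- by apply: continuous_subspaceT; exact: continuous_expR_decay.
- split=> [s _||]; first exact: ex_derive.
  + exact/cvg_at_right_filter/cF.
  + exact/cvg_at_left_filter/cF.
- by move=> s _; rewrite derive1E; have [_ ->] := dF s.
Qed.

(** The vector [z = L u] is paired with itself, which turns its squared norm into a scalar integral,
    at most [|z| * bhat / eps]. This makes the supremum defining [omega] finite. *)
Lemma mnorm_Lmat_le B (h eps bhat t : R) : 0 < h -> 0 < eps -> 0 <= t ->
  continuous B -> (forall s, 0 <= s -> mnorm (B s) <= bhat) ->
  mnorm (Lmat B h eps t) <= bhat / eps.
Proof.
move=> h0 e0 t0 cB Bb; apply: mnorm_le => u u1.
have bh0 : 0 <= bhat by apply: le_trans (Bb 0 (lexx 0)); exact: mnorm_ge0.
set z := _ *m u.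
have [z0|z0] := eqVneq (enorm z) 0; first by rewrite z0 divr_ge0// ltW.
have zp : 0 < enorm z by rewrite lt_neqAle eq_sym z0 enorm_ge0.
have cF i : continuous
    (fun s => (expR (- (eps * (t + h - s))) *: (B s *m u)) i ord0).
  under eq_fun do rewrite mxE.
  move=> s; apply: cvgM; first exact: continuous_expR_decay.
  apply: mulmx_coord_continuous; last exact: cst_continuous.
  by move=> j; exact: continuous_coord.
rewrite -(ler_pM2l zp) -expr2 -dotvv {2}/z Lmat_mul// dotv_vint//.
apply: (@le_trans _ _ (rint 0 (t + h)
  (fun s => enorm z * bhat * expR (- (eps * (t + h - s)))))).
  apply: rint_le.
  - by apply: continuous_dotv => // i; exact: cst_continuous.
  - by move=> s; apply: cvgM; [exact: cvg_cst|exact: continuous_expR_decay].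
  - move=> s /andP[s0 _]; rewrite dotvZr mulrC ler_wpM2r ?expR_ge0//.
    apply: le_trans (dotv_le _ _) _; rewrite ler_pM2l//.
    apply: le_trans (mulmx_mnorm _ _) _; rewrite -[leRHS]mulr1.
    by rewrite ler_pM ?mnorm_ge0 ?enorm_ge0 ?Bb.
rewrite rintZ; last exact: continuous_expR_decay.
rewrite mulrA ler_wpM2l ?mulr_ge0 ?(ltW zp)//.
by apply: rint_expR_le => //; rewrite ltr_wpDl.
Qed.

Lemma eq_Lmat B B' (h eps t : R) : (forall s, 0 <= s -> B s = B' s) ->
  Lmat B h eps t = Lmat B' h eps t.
Proof.
move=> BB'; apply/matrixP => i j; rewrite !mxE.
by apply: rint_eq => s /andP[s0 _]; rewrite BB'.
Qed.

(** For [t >= 0] the functional evaluates B at nonnegative times only, since [t + th + h >= 0].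
    Hence B and x may be replaced by their clamped extensions. *)
Lemma eq_vfun (f Q : 'cV[R]_n * 'cV[R]_n -> 'cV[R]_n) B B' V
    (h eps gamma mu w1 w2 t : R) phi psi :
  0 <= h -> 0 <= t -> (forall th, - h <= th <= 0 -> phi th = psi th) ->
  (forall s, 0 <= s -> B s = B' s) ->
  vfun f Q B V h eps gamma mu w1 w2 t phi = vfun f Q B' V h eps gamma mu w1 w2 t psi.
Proof.
move=> h0 t0 phipsi BB'.
have E0 : phi 0 = psi 0 by apply: phipsi; rewrite lexx oppr_le0 h0.
have Ev : vint (- h) 0 (fun th => f (psi 0, phi th) + B (t + th + h) *m Q (psi 0, phi th))
    = vint (- h) 0 (fun th => f (psi 0, psi th) + B' (t + th + h) *m Q (psi 0, psi th)).
  apply/matrixP => i j; rewrite !mxE; apply: rint_eq => th thh.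
  rewrite phipsi// BB'//; case/andP: thh => th0 _.
  by rewrite -addrA addr_ge0// -lerBlDr sub0r.
have Er : rint (- h) 0 (fun th => (w1 + (h + th) * w2) * enorm (phi th) `^ (gamma + mu - 1))
    = rint (- h) 0 (fun th => (w1 + (h + th) * w2) * enorm (psi th) `^ (gamma + mu - 1)).
  by apply: rint_eq => th thh; rewrite phipsi.
by rewrite /vfun E0 (eq_Lmat h eps t BB') Ev Er.
Qed.

End functional.

Lemma continuous_subv_coord (R : realType) (n : nat) (T : topologicalType)
    (u v : T -> 'cV[R]_n) i :
  (forall j, continuous (fun t => u t j ord0)) ->
  (forall j, continuous (fun t => v t j ord0)) ->
  continuous (fun t => (u t - v t) i ord0).
Proof.
move=> cu cv.
have -> : (fun t => (u t - v t) i ord0) = (fun t => u t i ord0 - v t i ord0).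
  by apply/funext => t; rewrite 2!mxE.
by move=> t; apply: cvgB; [exact: cu|exact: cv].
Qed.

(** * Continuity of v along a trajectory and its bound at time 0 *)

Section along_solution.
Variables (R : realType) (n : nat) (f Q : 'cV[R]_n * 'cV[R]_n -> 'cV[R]_n).
Variables (B : R -> 'M[R]_n) (V : 'cV[R]_n -> R) (x : R -> 'cV[R]_n).
Variables (h eps gamma mu w1 w2 : R).
Hypotheses (cf : continuous f) (cQ : continuous Q) (cB : continuous B).
Hypotheses (cV : continuous V) (cx : continuous x).
Hypothesis cgrad : forall i, continuous (fun y : 'cV[R]_n => grad V y i ord0).
Hypothesis h_gt0 : 0 < h.
Hypothesis exponent_gt0 : 0 < gamma + mu - 1.

Lemma continuous_integrand i : continuous (fun z : R * R =>
  (f (x z.1, x (z.1 + z.2)) + B (z.1 + z.2 + h) *m Q (x z.1, x (z.1 + z.2))) i ord0).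
Proof.
have c12 : continuous (fun z : R * R => z.1 + z.2).
  by move=> z; apply: cvgD; [exact: cvg_fst|exact: cvg_snd].
have cxx : continuous (fun z : R * R => (x z.1, x (z.1 + z.2))).
  apply: continuous_pair => z.
    by apply: (@continuous_comp _ _ _ fst x); [exact: cvg_fst|exact: cx].
  by apply: (@continuous_comp _ _ _ (fun z => z.1 + z.2) x); [exact: c12|exact: cx].
under eq_fun do rewrite mxE.
move=> z; apply: cvgD.
  apply: (@continuous_coord _ _ _ _ (fun z => f (x z.1, x (z.1 + z.2)))).
  by move=> u; apply: (@continuous_comp _ _ _ _ f); [exact: cxx|exact: cf].
apply: (@mulmx_coord_continuous _ _ _ (fun z => B (z.1 + z.2 + h))
  (fun z => Q (x z.1, x (z.1 + z.2)))) => [j|u].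
  apply: continuous_coord => u.
  apply: (@continuous_comp _ _ _ (fun z => z.1 + z.2 + h) B); last exact: cB.
  by apply: cvgD; [exact: c12|exact: cvg_cst].
by apply: (@continuous_comp _ _ _ _ Q); [exact: cxx|exact: cQ].
Qed.

Lemma continuous_weighted_norm (p : R) : 0 < p -> continuous (fun z : R * R =>
  (w1 + (h + z.2) * w2) * enorm (x (z.1 + z.2)) `^ p).
Proof.
move=> p0 z; apply: cvgM.
  apply: cvgD; first exact: cvg_cst.
  apply: cvgM; last exact: cvg_cst.
  by apply: cvgD; [exact: cvg_cst|exact: cvg_snd].
apply: (@continuous_powR _ _ (fun z : R * R => enorm (x (z.1 + z.2))) p) => //;
  last by move=> u; exact: enorm_ge0.
apply: continuous_enorm => u.
apply: (@continuous_comp _ _ _ (fun z => z.1 + z.2) x); last exact: cx.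
by apply: cvgD; [exact: cvg_fst|exact: cvg_snd].
Qed.

(* The factor depending on t is taken out of the integral defining L. *)
Lemma continuous_Lmat i j : continuous (fun t : R => Lmat B h eps `|t| i j).
Proof.
pose g s := expR (eps * s) * B s i j.
have cg : continuous g.
  move=> s; apply: cvgM; last exact: (@continuous_coord _ _ _ _ B).
  apply: (@continuous_comp _ _ _ (fun s => eps * s) expR); last exact: continuous_expR.
  by apply: cvgM; [exact: cvg_cst|exact: cvg_id].
have -> : (fun t : R => Lmat B h eps `|t| i j) =
    (fun t : R => expR (- (eps * (`|t| + h))) * rint 0 (`|t| + h) g).
  apply/funext => t; rewrite mxE -rintZ//; apply: rint_eq => s _.
  by rewrite mxE mulrA -expRD; congr (expR _ * _); ring.
have ca : continuous (fun t : R => `|t| + h).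
  by move=> t; apply: cvgD; [exact: norm_continuous|exact: cvg_cst].
move=> t; apply: cvgM.
  apply: (@continuous_comp _ _ _ (fun t : R => - (eps * (`|t| + h))) expR);
    last exact: continuous_expR.
  by apply: cvgN; apply: cvgM; [exact: cvg_cst|exact: ca].
apply: (@continuous_comp _ _ _ (fun t : R => `|t| + h) (fun T => rint 0 T g)).
  exact: ca.
by apply: continuous_rint_upper => //; rewrite ltr_wpDl.
Qed.

(** The absolute value extends the functional to negative times, as the comparison argument works
    with functions continuous on the whole line; it also keeps the upper limit of the integral in L
    positive. *)
Lemma continuous_vfun :
  continuous (fun t : R => vfun f Q B V h eps gamma mu w1 w2 `|t| (state x `|t|)).
Proof.
have cxa : continuous (fun t : R => x `|t|).
  by move=> t; apply: (@continuous_comp _ _ _ _ x); [exact: norm_continuous|exact: cx].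
have cpar (F : R * R -> R) : continuous F ->
    continuous (fun t : R => rint (- h) 0 (fun s => F (`|t|, s))).
  move=> cF t; apply: (@continuous_comp _ _ _ (fun t : R => `|t|)
    (fun t : R => rint (- h) 0 (fun s => F (t, s)))); first exact: norm_continuous.
  exact: continuous_rint_param.
rewrite /vfun /state; under eq_fun do rewrite addr0.
move=> t; apply: cvgD; last first.
  exact: (cpar _ (continuous_weighted_norm exponent_gt0)).
apply: cvgD.
  by apply: (@continuous_comp _ _ _ (fun t : R => x `|t|) V); [exact: cxa|exact: cV].
apply: (@continuous_dotv _ _ _ (fun t : R => grad V (x `|t|))) => i.
  move=> s; apply: (@continuous_comp _ _ _ (fun t : R => x `|t|)
    (fun y : 'cV[R]_n => grad V y i ord0)); [exact: cxa|exact: cgrad].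
apply: continuous_subv_coord => k.
  by under eq_fun do rewrite mxE; exact: (cpar _ (@continuous_integrand k)).
apply: (@mulmx_coord_continuous _ _ _ (fun t : R => Lmat B h eps `|t|)
  (fun t : R => Q (x `|t|, x `|t|))); first exact: continuous_Lmat.
move=> v; apply: (@continuous_comp _ _ _ (fun t : R => (x `|t|, x `|t|)) Q);
  last exact: cQ.
exact: continuous_pair.
Qed.

(** The origin of [b2], [b3] and [K]: every norm in v is replaced by [r], and [l] bounds L at time
    0. The term V gives [alpha1]; f and the weighted integral give the power [mu - 1]; the two terms
    with Q give the power [sigma - 1]. *)
Lemma vfun0_le (sigma m1 m2 p1 p2 beta alpha1 bhat l r : R) :
  0 < r -> 0 <= w1 -> 0 <= w2 -> 0 <= m1 -> 0 <= m2 -> 0 <= p1 -> 0 <= p2 ->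
  0 <= beta -> 0 <= alpha1 -> 1 <= gamma -> 0 <= mu -> 0 <= sigma ->
  (forall x1 x2, enorm (f (x1, x2)) <= m1 * enorm x1 `^ mu + m2 * enorm x2 `^ mu) ->
  (forall x1 x2, enorm (Q (x1, x2)) <= p1 * enorm x1 `^ sigma + p2 * enorm x2 `^ sigma) ->
  (forall t, 0 <= t -> mnorm (B t) <= bhat) ->
  (forall y, enorm (grad V y) <= beta * enorm y `^ (gamma - 1)) ->
  (forall y, V y <= alpha1 * enorm y `^ gamma) ->
  mnorm (Lmat B h eps 0) <= l ->
  (forall th, - h <= th <= 0 -> enorm (x th) <= r) ->
  vfun f Q B V h eps gamma mu w1 w2 0 (state x 0) <=
    (alpha1 + (beta * (m1 + m2) + w1 + h * w2) * h * r `^ (mu - 1)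
      + beta * (p1 + p2) * (bhat * h + l) * r `^ (sigma - 1)) * r `^ gamma.
Proof.
move=> r0 w10 w20 m10 m20 p10 p20 be0 al0 ga1 mu0 si0 fb Qb Bb gb Vb Ll xr.
have rle0 := ltW r0.
have x0r : enorm (x 0) <= r by apply: xr; rewrite lexx oppr_le0 ltW.
have pw (a q : R) : 0 <= a -> a <= r -> 0 <= q -> a `^ q <= r `^ q.
  by move=> a0 ar q0; rewrite ge0_ler_powR ?nnegrE// (le_trans a0).
have bh0 : 0 <= bhat by apply: le_trans (Bb 0 (lexx 0)); exact: mnorm_ge0.
have fle th : - h <= th <= 0 -> enorm (f (x 0, x th)) <= (m1 + m2) * r `^ mu.
  move=> thh; apply: le_trans (fb _ _) _; rewrite mulrDl.
  by rewrite lerD// ler_wpM2l// pw ?enorm_ge0// xr.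
have Qle th : - h <= th <= 0 -> enorm (Q (x 0, x th)) <= (p1 + p2) * r `^ sigma.
  move=> thh; apply: le_trans (Qb _ _) _; rewrite mulrDl.
  by rewrite lerD// ler_wpM2l// pw ?enorm_ge0// xr.
have gle : enorm (grad V (x 0)) <= beta * r `^ (gamma - 1).
  by apply: le_trans (gb _) _; rewrite ler_wpM2l// pw ?enorm_ge0// subr_ge0.
have -> : vfun f Q B V h eps gamma mu w1 w2 0 (state x 0) =
   V (x 0) + (rint (- h) 0 (fun th => dotv (grad V (x 0))
       (f (x 0, x (0 + th)) + B (0 + th + h) *m Q (x 0, x (0 + th))))
     + dotv (grad V (x 0)) (- (Lmat B h eps 0 *m Q (x 0, x 0))))
   + rint (- h) 0 (fun th => (w1 + (h + th) * w2) * enorm (x (0 + th)) `^ (gamma + mu - 1)).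
  rewrite /vfun /state addr0 dotvDr dotv_vint// => i s.
  apply: (@continuous_comp _ _ _ (fun s : R => (0 : R, s)) (fun z : R * R =>
    (f (x z.1, x (z.1 + z.2)) + B (z.1 + z.2 + h) *m Q (x z.1, x (z.1 + z.2))) i ord0)).
    by apply: continuous_pair => u; [exact: cvg_cst|exact: cvg_id].
  exact: continuous_integrand.
pose G := beta * r `^ (gamma - 1).
have G0 : 0 <= G by rewrite mulr_ge0 ?powR_ge0.
have rintC (c : R) : rint (- h) 0 (fun=> c) = h * c.
  by rewrite rint_cst ?sub0r ?opprK// oppr_le0 ltW.
have I1 : rint (- h) 0 (fun th => dotv (grad V (x 0))
       (f (x 0, x (0 + th)) + B (0 + th + h) *m Q (x 0, x (0 + th)))) <=
    h * (G * ((m1 + m2) * r `^ mu + bhat * ((p1 + p2) * r `^ sigma))).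
  rewrite -rintC.
  apply: rint_le; last first.
  - move=> th thh; rewrite add0r; apply: le_trans (dotv_le _ _) _.
    rewrite ler_pM ?enorm_ge0//; apply: le_trans (enormD _ _) _.
    rewrite lerD ?fle//; apply: le_trans (mulmx_mnorm _ _) _.
    rewrite ler_pM ?mnorm_ge0 ?enorm_ge0 ?Qle// Bb//.
    by case/andP: thh => th0 _; rewrite -lerBlDr sub0r.
  - exact: cst_continuous.
  - apply: continuous_dotv => i; first exact: cst_continuous.
    move=> s; apply: (@continuous_comp _ _ _ (fun s : R => (0 : R, s)) (fun z : R * R =>
      (f (x z.1, x (z.1 + z.2)) + B (z.1 + z.2 + h) *m Q (x z.1, x (z.1 + z.2))) i ord0)).
      by apply: continuous_pair => u; [exact: cvg_cst|exact: cvg_id].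
    exact: continuous_integrand.
have I2 : dotv (grad V (x 0)) (- (Lmat B h eps 0 *m Q (x 0, x 0))) <=
    G * (l * ((p1 + p2) * r `^ sigma)).
  apply: le_trans (dotv_le _ _) _; rewrite enormN ler_pM ?enorm_ge0//.
  apply: le_trans (mulmx_mnorm _ _) _.
  by rewrite ler_pM ?mnorm_ge0 ?enorm_ge0 ?Qle// lexx oppr_le0 ltW.
have I3 : rint (- h) 0 (fun th => (w1 + (h + th) * w2) * enorm (x (0 + th)) `^ (gamma + mu - 1))
    <= h * ((w1 + h * w2) * r `^ (gamma + mu - 1)).
  rewrite -rintC.
  apply: rint_le; last first.
  - move=> th /andP[th0 th1].
    have hth : 0 <= h + th by rewrite -lerBlDl sub0r.
    rewrite ler_pM ?powR_ge0 ?addr_ge0 ?mulr_ge0//.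
      by rewrite lerD2l ler_wpM2r// gerDl.
    by rewrite pw ?enorm_ge0 ?add0r ?xr ?th0// ltW.
  - exact: cst_continuous.
  - move=> s; apply: (@continuous_comp _ _ _ (fun s : R => (0 : R, s)) (fun z : R * R =>
      (w1 + (h + z.2) * w2) * enorm (x (z.1 + z.2)) `^ (gamma + mu - 1))).
      by apply: continuous_pair => u; [exact: cvg_cst|exact: cvg_id].
    exact: continuous_weighted_norm.
have I0 : V (x 0) <= alpha1 * r `^ gamma.
  apply: le_trans (Vb _) _; rewrite ler_wpM2l// pw ?enorm_ge0//.
  exact: le_trans ga1.
(* The four bounds add up to exactly the right-hand side; what remains is an identity between powers
   of [r]. *)
apply: le_trans (lerD (lerD I0 (lerD I1 I2)) I3) _.
have rD (a b : R) : r `^ (a + b) = r `^ a * r `^ b.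
  by rewrite powRD//; apply/implyP => _; rewrite gt_eqF.
have rN1 : r `^ (-1) = r^-1 by rewrite powR_inv1.
rewrite /G !rD rN1 le_eqVlt; apply/orP; left; apply/eqP.
by field; rewrite gt_eqF.
Qed.

End along_solution.

(** * The explicit decay rate and the theorem *)

(** The initial parameter [w] is factored out of the profile, with
    [1 / w = K ^ kappa * r ^ (mu - 1)], and the [gamma]-th root is taken; [kappa * gamma = mu - 1]
    gives the final exponent. *)
Lemma le_of_profile (R : realType) (K a1 r gamma mu rho t y : R) :
  let kappa := (mu - 1) / gamma in
  0 < K -> 0 < a1 -> 0 < r -> 0 < gamma -> 1 < mu -> 0 <= rho -> 0 <= t -> 0 <= y ->
  a1 * y `^ gamma <= profile (rho * kappa) kappa^-1 ((K * r `^ gamma) `^ (- kappa)) t ->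
  y <= (K / a1) `^ (1 / gamma) * r
       * (1 + rho * kappa * K `^ kappa * r `^ (mu - 1) * t) `^ (- (1 / (mu - 1))).
Proof.
move=> kappa K0 a10 r0 g0 mu1 rho0 t0 y0.
have m0 : 0 < mu - 1 by rewrite subr_gt0.
have k0 : 0 < kappa by rewrite divr_gt0.
set w := _ `^ (- kappa).
have Kr : 0 < K * r `^ gamma by rewrite mulr_gt0 ?powR_gt0.
have w0 : 0 < w by rewrite powR_gt0.
set q := rho * kappa * K `^ kappa * r `^ (mu - 1) * t.
have q0 : 0 <= q.
  by rewrite mulr_ge0 ?powR_ge0// mulr_ge0 ?powR_ge0// mulr_ge0 ?powR_ge0// mulr_ge0 ?(ltW k0).
have wV : K `^ kappa * r `^ (mu - 1) = w^-1.
  rewrite /w powRN invrK powRM ?powR_ge0 ?(ltW K0)// -powRrM.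
  by congr (_ * _ `^ _); rewrite /kappa mulrC divfK ?gt_eqF.
have wq : w + rho * kappa * `|t| = w * (1 + q).
  rewrite ger0_norm// mulrDr mulr1; congr (_ + _).
  have -> : q = rho * kappa * t * w^-1 by rewrite -wV /q; ring.
  by rewrite [RHS]mulrC divfK ?gt_eqF.
rewrite /profile wq powRM ?(ltW w0) ?addr_ge0//.
have -> : w `^ (- kappa^-1) = K * r `^ gamma.
  by rewrite -powRrM mulrNN mulfV ?gt_eqF// powRr1// ltW.
set Z := (K / a1) `^ _ * r * _.
have Z0 : 0 <= Z by rewrite /Z mulr_ge0 ?powR_ge0// mulr_ge0 ?powR_ge0 ?(ltW r0).
have -> : K * r `^ gamma * (1 + q) `^ (- kappa^-1) = a1 * Z `^ gamma.
  rewrite powRM ?mulr_ge0 ?powR_ge0 ?(ltW r0)// powRM ?powR_ge0 ?(ltW r0)//.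
  rewrite -!powRrM mul1r mulVf ?gt_eqF// powRr1 ?divr_ge0 ?ltW//.
  have -> : - (1 / (mu - 1)) * gamma = - kappa^-1.
    by rewrite /kappa invf_div; field; rewrite gt_eqF.
  by field; rewrite gt_eqF.
rewrite ler_pM2l//; apply: contraTT; rewrite -!ltNge => Zy.
by rewrite gt0_ltr_powR ?nnegrE.
Qed.

Lemma enorm_ebasis (R : realType) (n : nat) (i : 'I_n) : enorm (ebasis R i) = 1.
Proof.
rewrite /enorm (bigD1 i)//= big1 => [|j /negPf ji].
  by rewrite addr0 mxE !eqxx expr1n sqrtr1.
by rewrite mxE ji expr0n.
Qed.

(** Treats both perturbation classes at once. For [eps > 0] the value at time 0 is below the
    supremum because the set is bounded, here by [bhat]. *)
Lemma Lmat0_le_omega (R : realType) (n : nat) (B : R -> 'M[R]_n)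
    (h eps bhat l0 : R) :
  0 < h -> 0 <= eps -> (eps = 0 -> mnorm (Lmat B h 0 0) <= l0) ->
  {within `[0, +oo[, continuous B} -> (forall t, 0 <= t -> mnorm (B t) <= bhat) ->
  mnorm (Lmat B h eps 0) <= omega_over_eps B h eps l0.
Proof.
move=> h0; rewrite le_eqVlt /omega_over_eps => /predU1P[<- L0 _ _|e0 _ cB Bb].
  by rewrite eqxx L0.
rewrite gt_eqF// ler_pdivlMr// mulrC; apply: ub_le_sup; last first.
  by exists 0 => //=; rewrite in_itv/= lexx.
exists (eps * (bhat / eps)) => z [t /=]; rewrite in_itv/= andbT => t0 <-.
rewrite ler_pM2l//.
have cBB := continuous_clamp cB.
rewrite (@eq_Lmat _ _ B (fun t => B (Num.max t 0))) => [|s s0]; last by rewrite max_l.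
by apply: mnorm_Lmat_le => // s s0; rewrite max_l// Bb.
Qed.

Lemma isC_state (R : realType) (n : nat) (h t : R) (x : R -> 'cV[R]_n) :
  0 <= t -> {within `[- h, +oo[, continuous x} -> isC h (state x t).
Proof.
move=> t0 cx; have cxx := continuous_clamp cx.
apply: (@subspace_eq_continuous _ _ _ (fun th => x (Num.max (t + th) (- h)))).
  move=> th; rewrite inE/= in_itv/= => /andP[th0 _]; rewrite /state max_l//.
  by rewrite (le_trans th0)// lerDr.
apply: continuous_subspaceT => th.
apply: (@continuous_comp _ _ _ (fun th => t + th) (fun s => x (Num.max s (- h)))).
  by apply: cvgD; [exact: cvg_cst|exact: cvg_id].
exact: cxx.
Qed.

Lemma le_right_limit_decay (R : realType) (y r Delta c1 c2 mu t : R) :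
  0 <= r -> r < Delta -> 0 <= c2 -> 0 <= t -> 1 < mu ->
  (forall s, r < s -> s < Delta ->
     y <= c1 * s * (1 + c2 * s `^ (mu - 1) * t) `^ (- (1 / (mu - 1)))) ->
  y <= c1 * r * (1 + c2 * r `^ (mu - 1) * t) `^ (- (1 / (mu - 1))).
Proof.
move=> r0 rD c20 t0 mu1 Hs.
(* With [|u|] the base of the inner power is nonnegative on both sides of [r], so [F] is continuous
   at [r] even when [r = 0]. *)
pose F u := c1 * u * (1 + c2 * `|u| `^ (mu - 1) * t) `^ (- (1 / (mu - 1))).
have cF : {for r, continuous F}.
  apply: cvgM; first by apply: cvgM; [exact: cvg_cst|exact: cvg_id].
  apply: (@continuous_comp _ _ _ (fun u => 1 + c2 * `|u| `^ (mu - 1) * t)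
    (fun z => z `^ (- (1 / (mu - 1))))).
    apply: cvgD; first exact: cvg_cst.
    apply: cvgM; last exact: cvg_cst.
    apply: cvgM; first exact: cvg_cst.
    apply: (@continuous_powR _ _ (fun u : R => `|u|)) => //; last by rewrite subr_gt0.
    exact: norm_continuous.
  apply/differentiable_continuous/derivable1_diffP.
  apply: derivable_powR; rewrite in_itv/= andbT ltr_pwDl// !mulr_ge0// powR_ge0.
have -> : c1 * r * (1 + c2 * r `^ (mu - 1) * t) `^ (- (1 / (mu - 1))) = F r.
  by rewrite /F ger0_norm.
apply: cvgr_to_ge (cvg_at_right_filter cF) _; near=> s.
have rs : r < s by [].
by rewrite /F ger0_norm ?(le_trans r0 (ltW rs))//; exact: Hs.
Unshelve. all: by end_near.
Qed.

Theorem theorem3 (R : realType) (n : nat) (hn : (0 < n)%N) (h : R) (hh : 0 < h)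
  (f Q : 'cV[R]_n * 'cV[R]_n -> 'cV[R]_n) (B : R -> 'M[R]_n) (V : 'cV[R]_n -> R)
  (mu sigma gamma m1 m2 eta11 eta12 bhat p1 p2 q11 q12 q21 q22
   w alpha0 alpha1 beta psi w1 w2 eps l0 : R)
  (* assumption (i) on f *)
  (hf_lip : loc_lipschitz f) (hf_C1 : C1_pair f) (hmu : 1 < mu)
  (hf_hom : forall (c : R) x1 x2, 0 < c -> f (c *: x1, c *: x2) = powR c mu *: f (x1, x2))
  (hm1 : 0 <= m1) (hm2 : 0 <= m2) (heta11 : 0 <= eta11) (heta12 : 0 <= eta12)
  (hf_bd : forall x1 x2, enorm (f (x1, x2)) <= m1 * powR (enorm x1) mu + m2 * powR (enorm x2) mu)
  (hf_d1 : forall x1 x2, opnorm (pd1 f x1 x2)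
             <= eta11 * powR (enorm x1) (mu - 1) + eta12 * powR (enorm x2) (mu - 1))
  (* assumption (ii) on B *)
  (hB_cont : {within `[0, +oo[, continuous B})
  (hB_bd : forall t, 0 <= t -> mnorm (B t) <= bhat)
  (* assumption (iii) on Q *)
  (hQ_C1 : C1_pair Q) (hsigma : 1 < sigma)
  (hp1 : 0 <= p1) (hp2 : 0 <= p2)
  (hq11 : 0 <= q11) (hq12 : 0 <= q12) (hq21 : 0 <= q21) (hq22 : 0 <= q22)
  (hQ_bd : forall x1 x2, enorm (Q (x1, x2)) <= p1 * powR (enorm x1) sigma + p2 * powR (enorm x2) sigma)
  (hQ_d1 : forall x1 x2, opnorm (pd1 Q x1 x2)
             <= q11 * powR (enorm x1) (sigma - 1) + q12 * powR (enorm x2) (sigma - 1))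
  (hQ_d2 : forall x1 x2, opnorm (pd2 Q x1 x2)
             <= q21 * powR (enorm x1) (sigma - 1) + q22 * powR (enorm x2) (sigma - 1))
  (* assumption (iv) *)
  (hstab : asympt_stable0 f)
  (hV_C2 : C2_scalar V) (hgamma : 2 <= gamma)
  (hV_pd : V 0 = 0 /\ forall x, x != 0 -> 0 < V x)
  (hV_hom : forall (c : R) x, 0 < c -> V (c *: x) = powR c gamma * V x)
  (hw : 0 < w) (halpha0 : 0 < alpha0) (halpha1 : 0 < alpha1) (hbeta : 0 < beta) (hpsi : 0 < psi)
  (hV_der : forall x, dotv (grad V x) (f (x, x)) <= - w * powR (enorm x) (gamma + mu - 1))
  (hV_bd : forall x, alpha0 * powR (enorm x) gamma <= V x <= alpha1 * powR (enorm x) gamma)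
  (hV_grad : forall x, enorm (grad V x) <= beta * powR (enorm x) (gamma - 1))
  (hV_hess : forall x, opnorm (hess V x) <= psi * powR (enorm x) (gamma - 2))
  (* perturbation class: case (a) with eps = 0 and ||L(t,0)|| <= l0, or case (b) with eps > 0 *)
  (hcase : (case_a B mu sigma /\ eps = 0 /\ 0 < l0 /\
              forall t, 0 <= t -> mnorm (Lmat B h 0 t) <= l0)
           \/ (case_b B mu sigma /\ 0 < eps))
  (* w1, w2 *)
  (hw1 : 0 < w1) (hw2 : 0 < w2) (hw0 : 0 < w - w1 - h * w2)
  (* constants of (L1), (L2), (L3) *)
  (alpha delta c0 c1 c2 a1 b0 b1 : R)
  (halpha : 1 < alpha) (hdelta : 0 < delta)
  (hc0 : 0 < c0) (hc1 : 0 < c1) (hc2 : 0 < c2) (ha1 : 0 < a1) (hb0 : 0 < b0) (hb1 : 0 < b1)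
  (hL1 : forall (phi x : R -> 'cV[R]_n), isC h phi -> is_solS f Q B h phi x ->
     forall t, 0 <= t -> normh h (state x t) <= delta ->
     rderiv_le (fun s => vfun f Q B V h eps gamma mu w1 w2 s (state x s)) t
       (- c0 * powR (enorm (x t)) (gamma + mu - 1)
        - c1 * powR (enorm (x (t - h))) (gamma + mu - 1)
        - c2 * rint (- h) 0 (fun th => powR (enorm (x (t + th))) (gamma + mu - 1))))
  (hL2 : forall t (phi : R -> 'cV[R]_n), 0 <= t -> isC h phi -> S_alpha h alpha phi ->
     normh h phi <= delta ->
     a1 * powR (enorm (phi 0)) gamma
       + w1 * rint (- h) 0 (fun th => powR (enorm (phi th)) (gamma + mu - 1))
     <= vfun f Q B V h eps gamma mu w1 w2 t phi)
  (hL3 : forall t (phi : R -> 'cV[R]_n), 0 <= t -> isC h phi -> normh h phi <= delta ->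
     vfun f Q B V h eps gamma mu w1 w2 t phi
     <= b0 * powR (enorm (phi 0)) gamma + b1 * rint (- h) 0 (fun th => powR (enorm (phi th)) gamma))
  (Delta rho_t : R) :
  let m := m1 + m2 in
  let p := p1 + p2 in
  let b2 := (beta * m + w1 + h * w2) * h in
  let b3 := beta * p * (bhat * h + omega_over_eps B h eps l0) in
  let b := Num.max b0 b1 in
  let c := Num.min c0 c2 in
  let K := alpha1 + b2 * powR Delta (mu - 1) + b3 * powR Delta (sigma - 1) in
  let rho := c / (powR b ((gamma + mu - 1) / gamma)
                  * powR (2 * Num.max 1 h) ((mu - 1) / gamma)) in
  0 < Delta ->
  alpha1 * powR Delta gamma + b2 * powR Delta (gamma + mu - 1)
    + b3 * powR Delta (gamma + sigma - 1) = a1 * powR delta gamma ->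
  0 < rho_t -> rho_t < rho ->
  1 + rho_t * h * ((mu - 1) / gamma) * powR K ((mu - 1) / gamma) * powR Delta (mu - 1)
    <= powR alpha (mu - 1) ->
  let hc1 := powR (K / a1) (1 / gamma) in
  let hc2 := rho_t * ((mu - 1) / gamma) * powR K ((mu - 1) / gamma) in
  forall (phi x : R -> 'cV[R]_n), isC h phi -> normh h phi < Delta ->
    is_solS f Q B h phi x ->
    forall t, 0 <= t ->
      enorm (x t) <= hc1 * normh h phi
                     * powR (1 + hc2 * powR (normh h phi) (mu - 1) * t) (- (1 / (mu - 1))).
Proof.
move=> m p b2 b3 b c K rho Delta0 HDelta rt0 rtrho Halpha hc1' hc2' phi x cphi rD solx t t0.
have [xphi [cx _]] := solx.
have g0 : 0 < gamma by apply: lt_le_trans hgamma.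
have m0 : 0 < mu - 1 by rewrite subr_gt0.
have mu0 : 0 < mu by apply: lt_trans hmu.
have gm0 : 0 < gamma + mu - 1 by rewrite -addrA addr_gt0.
have h0 := ltW hh.
pose kappa := (mu - 1) / gamma.
have k0 : 0 < kappa by rewrite divr_gt0.
have q1 : 1 < 1 + kappa by rewrite ltrDl.
have gq : gamma * (1 + kappa) = gamma + mu - 1.
  by rewrite /kappa; field; rewrite gt_eqF.
pose BB s := B (Num.max s 0); pose xx s := x (Num.max s (- h)).
have cBB : continuous BB by exact: continuous_clamp.
have cxx : continuous xx by exact: continuous_clamp.
have BBE s : 0 <= s -> BB s = B s by move=> s0; rewrite /BB max_l.
have xxE s : - h <= s -> xx s = x s by move=> hs; rewrite /xx max_l.
have cf : continuous f by move=> z; apply: differentiable_continuous; exact: hf_C1.1.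
have cQ : continuous Q by move=> z; apply: differentiable_continuous; exact: hQ_C1.1.
have cV : continuous V by move=> z; apply: differentiable_continuous; exact: hV_C2.1.
have cgrad i : continuous (fun y : 'cV[R]_n => grad V y i ord0).
  have -> : (fun y : 'cV[R]_n => grad V y i ord0) = (fun y => 'd V y (ebasis R i)).
    by apply/funext => z; rewrite mxE.
  by move=> z; apply: differentiable_continuous; exact: hV_C2.2.1.
have bh0 : 0 <= bhat by apply: le_trans (hB_bd 0 (lexx 0)); exact: mnorm_ge0.
have Ll : mnorm (Lmat B h eps 0) <= omega_over_eps B h eps l0.
  apply: Lmat0_le_omega hB_cont hB_bd => //.
    by case: hcase => [[_ [-> _]]//|[_ /ltW]].
  by case: hcase => [[_ [_ [_ L]]] _|[_ e0] e00]; [exact: L|rewrite e00 ltxx in e0].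
have b20 : 0 <= b2.
  by rewrite mulr_ge0// !addr_ge0 ?mulr_ge0 ?addr_ge0 ?(ltW hbeta) ?(ltW hw1) ?(ltW hw2).
have b30 : 0 <= b3.
  rewrite mulr_ge0//; first by rewrite mulr_ge0 ?addr_ge0 ?(ltW hbeta).
  by rewrite addr_ge0 ?mulr_ge0//; apply: le_trans Ll; exact: mnorm_ge0.
have K0 : 0 < K by rewrite /K -addrA ltr_pwDl// addr_ge0// mulr_ge0// powR_ge0.
(* The equation defining [Delta], with [Delta ^ gamma] factored out. *)
have KD : K * Delta `^ gamma = a1 * delta `^ gamma.
  have DE s : Delta `^ (gamma + s - 1) = Delta `^ gamma * Delta `^ (s - 1).
    by rewrite -addrA (@powRD _ _ gamma)// (gt_eqF Delta0) implybT.
  by rewrite -HDelta !DE /K; ring.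
(* Powers being monotone, the constant [K] taken at [Delta] serves for all smaller radii. *)
have vK (z : R -> 'cV[R]_n) s : continuous z -> 0 < s -> s <= Delta ->
    (forall th, - h <= th <= 0 -> enorm (z th) <= s) ->
    vfun f Q BB V h eps gamma mu w1 w2 0 (state z 0) <= K * s `^ gamma.
  move=> cz s0 sD zs.
  have := @vfun0_le _ _ f Q BB V z h eps gamma mu w1 w2 cf cQ cBB cz hh gm0
    sigma m1 m2 p1 p2 beta alpha1 bhat (omega_over_eps B h eps l0) s.
  move=> /(_ s0 (ltW hw1) (ltW hw2) hm1 hm2 hp1 hp2 (ltW hbeta) (ltW halpha1)).
  have g1 : 1 <= gamma by apply: le_trans hgamma; rewrite ler1n.
  move=> /(_ g1 (ltW mu0) (ltW (lt_trans ltr01 hsigma)) hf_bd hQ_bd).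
  have BBb u : 0 <= u -> mnorm (BB u) <= bhat by move=> u0; rewrite BBE// hB_bd.
  have Vb y : V y <= alpha1 * enorm y `^ gamma by case/andP: (hV_bd y).
  have Ll' : mnorm (Lmat BB h eps 0) <= omega_over_eps B h eps l0.
    by rewrite (eq_Lmat h eps 0 BBE).
  move=> /(_ BBb hV_grad Vb Ll' zs) /le_trans; apply.
  rewrite ler_wpM2r ?powR_ge0// /K.
  have sDp r : 0 <= r -> s `^ r <= Delta `^ r.
    by move=> r0; rewrite ge0_ler_powR ?nnegrE ?(ltW s0) ?(ltW Delta0).
  by rewrite lerD ?lerD2l// ler_wpM2l// sDp// ?subr_ge0 ltW.
(* (L2) at a constant state, against the upper bound of v at time 0. *)
have aK : a1 <= K.
  have [s s0 [sd sD]] : exists2 s, 0 < s & s <= delta /\ s <= Delta.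
    by exists (Num.min delta Delta); rewrite ?lt_min ?hdelta// !ge_min !lexx orbT.
  (* A vector of norm exactly [s], which exists because [n] is positive. *)
  pose z : 'cV[R]_n := s *: ebasis R (Ordinal hn).
  have zs : enorm z = s by rewrite enormZ enorm_ebasis mulr1 gtr0_norm.
  have nz : normh h (fun _ : R => z) <= delta.
    by apply: normh_le => // th _; rewrite zs.
  have cz : continuous (fun _ : R => z) by exact: cst_continuous.
  have Sz : S_alpha h alpha (fun _ : R => z).
    by move=> th _; rewrite ler_peMl ?enorm_ge0// ltW.
  have := hL2 0 (fun _ : R => z) (lexx 0) (continuous_subspaceT cz) Sz nz.
  have Ez := @eq_vfun _ _ f Q B BB V h eps gamma mu w1 w2 0
    (fun _ : R => z) (state (fun _ : R => z) 0) h0 (lexx 0) (fun _ _ => erefl) (fun s s0 => esym (BBE s s0)).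
  have zle th : - h <= th <= 0 -> enorm z <= s by rewrite zs.
  rewrite Ez => /le_trans/(_ (vK (fun _ : R => z) s cz s0 sD zle)); rewrite zs => H.
  rewrite -(ler_pM2r (powR_gt0 gamma s0)); apply: le_trans H; rewrite lerDl.
  by apply: mulr_ge0 (ltW hw1) (rint_ge0 _) => th _; exact: powR_ge0.
pose y (s : R) := enorm (xx s).
have cy : continuous y by exact: continuous_enorm.
have y0 s : 0 <= y s by exact: enorm_ge0.
have yE u th : 0 <= u -> - h <= th <= 0 -> y (u + th) = enorm (state x u th).
  move=> u0 /andP[th0 _]; rewrite /y /state xxE//; apply: le_trans th0 _.
  by rewrite lerDr.
have yt u : 0 <= u -> enorm (x u) = y u.
  by move=> u0; rewrite /y xxE// (le_trans _ u0)// oppr_le0.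
pose v (s : R) := vfun f Q BB V h eps gamma mu w1 w2 `|s| (state xx `|s|).
have cv : continuous v by exact: continuous_vfun.
have vE s : 0 <= s -> v s = vfun f Q B V h eps gamma mu w1 w2 s (state x s).
  move=> s0; rewrite /v (ger0_norm s0); apply: eq_vfun (h0) (s0) _ (BBE) => th /andP[th0 _].
  by rewrite /state xxE//; apply: le_trans th0 _; rewrite lerDr.
set r := normh h phi in rD *.
have phir th : - h <= th <= 0 -> enorm (phi th) <= r by exact: enorm_le_normh.
have r0 : 0 <= r.
  by apply: le_trans (phir 0 _); rewrite ?enorm_ge0// lexx oppr_le0 h0.
(* It remains to prove the estimate with any [r'] in []r, Delta[] in place of [r]. *)
apply: (le_right_limit_decay _ rD) => //.
  exact: mulr_ge0 (mulr_ge0 (ltW rt0) (ltW k0)) (powR_ge0 _ _).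
move=> r' rr' r'D.
have r'0 : 0 < r' by apply: le_lt_trans rr'.
rewrite yt//; apply: le_of_profile => //; first exact: ltW.
(* A second, positive radius below [r'], as [r] itself may be 0; it plays [r0] in [scalar_decay]. *)
have [s rs' sr'] : exists2 s, r < s & s < r'.
  by exists ((r + r') / 2); rewrite !midf_lt.
have s0 := le_lt_trans r0 rs'; have rs := ltW rs'.
have ys th : - h <= th <= 0 -> y th <= s.
  by move=> thh; rewrite /y xxE ?xphi ?(le_trans (phir _ _))//; case/andP: thh.
have normd u : 0 <= u -> (forall th, - h <= th <= 0 -> y (u + th) <= delta) ->
    normh h (state x u) <= delta.
  by move=> u0 yd; apply: (normh_le h0) => th thh; rewrite -(yE _ _ u0 thh) yd.
apply: (@scalar_decay _ h kappa gamma alpha delta Delta a1 K rho rho_t y v s r') => //.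
- exact: lt_trans halpha.
- exact: ltW.
- by rewrite KD.
(* The condition on [rho_t], stated at [Delta], passes to the smaller radius [r']. *)
- have -> : gamma * kappa = mu - 1 by rewrite /kappa mulrC divfK// gt_eqF.
  apply: le_trans Halpha; rewrite lerD2l.
  rewrite powRM ?powR_ge0 ?(ltW K0)// -powRrM.
  have -> : gamma * kappa = mu - 1 by rewrite /kappa mulrC divfK// gt_eqF.
  rewrite [rho_t * h * _]mulrAC -/kappa mulrA ler_wpM2l//.
    exact: mulr_ge0 (mulr_ge0 (mulr_ge0 (ltW rt0) (ltW k0)) h0) (powR_ge0 _ _).
  by rewrite ge0_ler_powR ?nnegrE// ltW.
- rewrite /v normr0; apply: vK cxx s0 _ ys; exact: ltW (lt_trans sr' r'D).
- move=> u u0 yd vu0.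
  have [D [HD Dle]] := hL1 phi x cphi solx u u0 (normd u u0 yd).
  exists D; split.
    (* Right difference quotients at [u >= 0] only see nonnegative times, where [v] is the original
       functional. *)
    apply: cvg_trans HD; apply: near_eq_cvg; near=> z.
    have z0 : 0 < z by [].
    by rewrite (vE _ u0) (vE _ (addr_ge0 u0 (ltW z0))).
  apply: le_trans Dle _.
  have cG : continuous (fun th => y (u + th) `^ gamma).
    apply: continuous_powR => // th.
    apply: (@continuous_comp _ _ _ (fun th => u + th) y); last exact: cy.
    by apply: cvgD; [exact: cvg_cst|exact: cvg_id].
  have v3 : v u <= b0 * y u `^ gamma + b1 * rint (- h) 0 (fun th => y (u + th) `^ gamma).
    rewrite (vE _ u0); apply: le_trans (hL3 u _ u0 (isC_state u0 cx) (normd u u0 yd)) _.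
    rewrite /state addr0 (yt _ u0).
    rewrite (@rint_eq _ _ _ _ (fun th => y (u + th) `^ gamma)) => [|th thh].
      exact: lexx.
    by rewrite (yE _ _ u0 thh).
  have := @dissipation_bound _ (1 + kappa) h (y u `^ gamma) (v u) b0 b1 c0 c2
    (fun th => y (u + th) `^ gamma) q1 h0 (powR_ge0 _ _) hb0 hb1 hc0 hc2 cG
    (fun _ => powR_ge0 _ _) vu0 v3.
  have -> : (1 + kappa) - 1 = (mu - 1) / gamma by rewrite addrC addKr.
  have kE : 1 + kappa = (gamma + mu - 1) / gamma
    by rewrite -gq [gamma * _]mulrC mulfK ?gt_eqF.
  rewrite -/b -/c {1}kE -/rho -powRrM gq.
  have -> : rint (- h) 0 (fun th => (y (u + th) `^ gamma) `^ (1 + kappa))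
      = rint (- h) 0 (fun th => enorm (x (u + th)) `^ (gamma + mu - 1)).
    by apply: rint_eq => th thh; rewrite -powRrM gq (yE _ _ u0 thh).
  (* The delayed term of (L1) has the favourable sign and is dropped. *)
  have : 0 <= c1 * enorm (x (u - h)) `^ (gamma + mu - 1).
    by rewrite mulr_ge0 ?powR_ge0// ltW.
  rewrite (yt _ u0).
  set X1 := rho * _; set X2 := rint _ _ _; set X3 := c1 * _; set X4 := y u `^ _.
  by move=> X30 X1le; rewrite lerNr !opprB; lra.
- move=> u u0 yd ya.
  have Su : S_alpha h alpha (state x u).
    move=> th thh; rewrite -(yE _ _ u0 thh); apply: le_trans (ya th thh) _.
    by rewrite /state addr0 (yt _ u0).
  have := hL2 u _ u0 (isC_state u0 cx) Su (normd u u0 yd).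
  rewrite -(vE _ u0) /state addr0 (yt _ u0); apply: le_trans.
  rewrite lerDl mulr_ge0 ?(ltW hw1)//.
  by apply: rint_ge0 => th _; exact: powR_ge0.
Unshelve. all: by end_near.
Qed.
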